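(* Let $V$ be an $\mathbb{F}_q$-vector space of finite dimension $r\ge1$, let $G:=\operatorname{Aut}_{\mathbb{F}_q}(V)$, let $G'\subset G$ be the subgroup of automorphisms of determinant $1$, and let $U$ be a maximal unipotent subgroup of $G$. The respective subrings of invariants are generated by algebraically independent homogeneous elements as follows (i.e., there exist elements $f_i,h_i,h'_r\in R_V$ and $g_i,k_i,k'_0\in S_V$, such that in each case the listed generators are algebraically independent over $\mathbb{F}_q$, homogeneous of the listed degrees, and the equality holds): (a) $R_V^U=\mathbb{F}_q[f_1,\ldots,f_r]$ with all degrees $-1$. (b) $S_V^U=\mathbb{F}_q[g_1,\ldots,g_r]$ with respective degrees $1,q,\ldots,q^{r-1}$. (c) $R_V^G=\mathbb{F}_q[h_1,\ldots,h_r]$ with respective degrees $1-q,1-q^2,\ldots,1-q^r$. (d) $S_V^G=\mathbb{F}_q[k_0,\ldots,k_{r-1}]$ with respective degrees $q^r-1,q^r-q,\ldots,q^r-q^{r-1}$. (e) $R_V^{G'}=\mathbb{F}_q[h_1,\ldots,h_{r-1},h'_r]$ with respective degrees $1-q,\ldots,1-q^{r-1},\frac{1-q^r}{q-1}$. (f) $S_V^{G'}=\mathbb{F}_q[k'_0,k_1,\ldots,k_{r-1}]$ with respective degrees $\frac{q^r-1}{q-1},q^r-q,\ldots,q^r-q^{r-1}$.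
   Context: $\mathbb{F}_q$ is a finite field with $q$ elements. $S_V$ is the symmetric algebra of $V$ over $\mathbb{F}_q$, $K_V$ its field of quotients, and $R_V\subset K_V$ the $\mathbb{F}_q$-subalgebra generated by $\frac1v$ for all $v\in V\setminus\{0\}$. The grading is such that each $v\in V\setminus\{0\}$ is homogeneous of degree $1$ and $\frac1v$ is homogeneous of degree $-1$. The groups $G$, $G'$, $U$ act on $S_V$ and $R_V$ by functoriality. In a suitable basis of $V$ the group $U$ corresponds to the group of upper-triangular matrices with all diagonal entries equal to $1$. A superscript denotes the subring of invariants. *)

(* Defs.v *)
From HB Require Import structures.
From mathcomp Require Import all_boot all_order all_algebra all_fingroup.
From mathcomp Require Import mpoly.
From mathcomp Require Import generic_quotient.

Set Implicit Arguments.
Unset Strict Implicit.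
Unset Printing Implicit Defensive.

Import GRing.Theory.
Local Open Scope ring_scope.

(* The group Aut_F(V), as a finGroupType whose law is composition. *)
Section GeneralLinear.
Variables (F : finFieldType) (V : vectType F).

Import VectorInternalTheory.
HB.instance Definition _ := [Countable of hom V V by <:].
HB.instance Definition _ := [Finite of hom V V by <:].

Record gl := Gl { gl_val :> 'End(V); _ : lker gl_val == 0%VS }.

HB.instance Definition _ := [isSub for gl_val].
HB.instance Definition _ := [Finite of gl by <:].

Lemma gl_lker0 (g : gl) : lker g == 0%VS. Proof. by case: g. Qed.

Lemma gl_one_subproof : lker (\1%VF : 'End(V)) == 0%VS.
Proof. by apply/lker0P=> u v; rewrite !id_lfunE. Qed.

Lemma gl_mul_subproof (g h : gl) : lker (g \o h)%VF == 0%VS.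
Proof.
apply/lker0P=> u v; rewrite !comp_lfunE.
by move=> /(lker0P (gl_lker0 g)) /(lker0P (gl_lker0 h)).
Qed.

Lemma gl_inv_subproof (g : gl) : lker (g^-1)%VF == 0%VS.
Proof.
apply/lker0P; apply: (can_inj (g := g)) => u; apply: lker0_lfunVK.
exact: gl_lker0.
Qed.

Definition gl_one := Gl gl_one_subproof.
Definition gl_mul g h := Gl (gl_mul_subproof g h).
Definition gl_inv g := Gl (gl_inv_subproof g).

Lemma gl_mulA : associative gl_mul.
Proof. by move=> f g h; apply: val_inj; rewrite /= comp_lfunA. Qed.

Lemma gl_mul1 : left_id gl_one gl_mul.
Proof. by move=> g; apply: val_inj; rewrite /= comp_lfun1l. Qed.

Lemma gl_mulV : left_inverse gl_one gl_inv gl_mul.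
Proof. by move=> g; apply: val_inj; rewrite /= lker0_compVf ?gl_lker0. Qed.

HB.instance Definition _ := Finite_isGroup.Build gl gl_mulA gl_mul1 gl_mulV.

Definition gl_det (g : gl) : F := \det (passmx.mxof (vbasis {:V}) (vbasis {:V}) g).

Definition sl : {set gl} := [set g | gl_det g == 1].

(* g - 1 is nilpotent *)
Definition unipotent (g : gl) : Prop :=
  exists n : nat, forall v : V, iter n (fun w => g w - w) v = 0.

Definition unipotent_subgroup (U : {group gl}) : Prop :=
  forall u, u \in U -> unipotent u.

Definition maximal_unipotent (U : {group gl}) : Prop :=
  unipotent_subgroup U /\
  forall W : {group gl}, unipotent_subgroup W -> U \subset W -> W = U.

End GeneralLinear.

(* The symmetric algebra of V is realized as the polynomial ring in the        *)
(* vectors of the basis [vbasis {:V}]; [symv] is the inclusion of V, and       *)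
(* [symv_universal] below is the universal property.                           *)
Notation SymAlg F V := {mpoly F[\dim {:V}]}.
Notation SymFrac F V := {fraction {mpoly F[\dim {:V}]}}.

Notation "x %:F" := (@FracField.tofrac _ x) : ring_scope.

Section FractionMap.
Variables R R' : idomainType.

Definition fracmap (phi : R -> R') (x : {fraction R}) : {fraction R'} :=
  (phi \n_(repr x))%:F / (phi \d_(repr x))%:F.

Lemma fracE (x : {fraction R}) : x = (\n_(repr x))%:F / (\d_(repr x))%:F.
Proof.
elim/quotW: x => x; set y := repr _.
have yx : \pi_{fraction R}%qT y = \pi_{fraction R}%qT x by rewrite reprK.
have d0 : (\d_y)%:F != 0 :> {fraction R} by rewrite tofrac_eq0 denom_ratioP.
apply: (canRL (mulfK d0)); rewrite -yx -[_ * _]/(FracField.mul _ _).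
unlock FracField.tofrac; rewrite -[LHS]FracField.pi_mul.
apply/eqmodP; rewrite /= FracField.equivfE /FracField.mulf.
by rewrite !numden_Ratio ?mulr1 ?mul1r ?oner_eq0 ?denom_ratioP // mulrC.
Qed.

Lemma fracmapE (phi : {rmorphism R -> R'}) (a b : R) :
  injective phi -> b != 0 ->
  fracmap phi (a%:F / b%:F) = (phi a)%:F / (phi b)%:F.
Proof.
move=> phi_inj b0; rewrite /fracmap.
set x := (a%:F / b%:F); set n := \n_(repr x); set d := \d_(repr x).
have phi0 z : z != 0 -> (phi z)%:F != 0 :> {fraction R'}.
  by rewrite tofrac_eq0 -(rmorph0 phi) (inj_eq phi_inj).
have d0 : d != 0 by apply: denom_ratioP.
have /eqP := fracE x; rewrite -/n -/d {1}/x eqr_div ?tofrac_eq0 //.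
rewrite -!tofracM tofrac_eq => /eqP E.
apply/eqP; rewrite eqr_div ?phi0 // -!tofracM tofrac_eq -!rmorphM.
by rewrite -E.
Qed.

End FractionMap.

Section Subalgebras.
Variables (F : fieldType) (A : comNzRingType) (c : F -> A).

(* In this section A is an F-algebra through the structure morphism c. *)
Inductive subalg (X : A -> Prop) : A -> Prop :=
| subalg_const a : subalg X (c a)
| subalg_gen x : X x -> subalg X x
| subalg_add x y : subalg X x -> subalg X y -> subalg X (x + y)
| subalg_mul x y : subalg X x -> subalg X y -> subalg X (x * y).

Definition algebraically_independent n (f : 'I_n -> A) : Prop :=
  forall p : {mpoly F[n]}, mmap c f p = 0 -> p = 0.

(* B = F[f_1, ..., f_n] with f_1, ..., f_n algebraically independent over F *)
Definition freely_generated (B : A -> Prop) n (f : 'I_n -> A) : Prop :=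
  algebraically_independent f /\
  forall x, B x <-> subalg (fun y => exists i, y = f i) x.

End Subalgebras.

Section SymmetricAlgebra.
Variables (F : finFieldType) (V : vectType F).

Definition symv (v : V) : SymAlg F V :=
  \sum_(i < \dim {:V}) coord (vbasis {:V}) i v *: 'X_i.

Definition symC (a : F) : SymAlg F V := a%:MP.
Definition symfracC (a : F) : SymFrac F V := (a%:MP)%:F.

Definition sym_act (g : gl V) : SymAlg F V -> SymAlg F V :=
  comp_mpoly [tuple symv (g (vbasis {:V})`_i) | i < \dim {:V}].

Definition symfrac_act (g : gl V) : SymFrac F V -> SymFrac F V :=
  fracmap (sym_act g).

Definition recip_alg : SymFrac F V -> Prop :=
  subalg symfracC (fun x => exists2 v : V, v != 0 & x = (symv v)%:F^-1).

Definition sym_inv (H : {set gl V}) (p : SymAlg F V) : Prop :=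
  forall g, g \in H -> sym_act g p = p.

Definition recip_inv (H : {set gl V}) (x : SymFrac F V) : Prop :=
  recip_alg x /\ forall g, g \in H -> symfrac_act g x = x.

(* The integer grading of the homogeneous localization of the symmetric        *)
(* algebra; it gives 1/v degree -1.                                            *)
Definition frac_homog (d : int) (x : SymFrac F V) : Prop :=
  exists m n (a b : SymAlg F V),
    [/\ a \is m.-homog, b \is n.-homog, b != 0,
        x = a%:F / b%:F & d = m%:Z - n%:Z].

Lemma symv_basis (i : 'I_(\dim {:V})) : symv (vbasis {:V})`_i = 'X_i.
Proof.
have Vb : free (vbasis {:V}) := basis_free (vbasisP _).
rewrite /symv (bigD1 i) //= coord_free // eqxx scale1r big1 ?addr0 // => j ji.
by rewrite coord_free // eq_sym (negPf ji) scale0r.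
Qed.

Lemma symv_linear : linear symv.
Proof.
move=> a u v; rewrite /symv scaler_sumr -big_split /=; apply: eq_bigr => i _.
by rewrite linearP scalerDl scalerA.
Qed.

Lemma symv_eq0 v : (symv v == 0) = (v == 0).
Proof.
apply/eqP/eqP => [v0|->]; last first.
  by rewrite /symv big1 // => i _; rewrite linear0 scale0r.
rewrite (coord_vbasis (memvf v)) big1 // => i _.
have := congr1 (mcoeff U_(i)) v0; rewrite mcoeff0 /symv linear_sum /=.
rewrite (bigD1 i) //= big1 ?addr0.
  by rewrite mcoeffZ mcoeffX eqxx mulr1 => ->; rewrite scale0r.
move=> j ji; rewrite mcoeffZ mcoeffX.
by rewrite eq_mnm1 (negPf ji) mulr0.
Qed.

HB.instance Definition _ := GRing.isLinear.Build F V (SymAlg F V) *:%R symv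
  symv_linear.

Lemma sym_morph_eq (A : comAlgType F) (Phi Psi : {lrmorphism SymAlg F V -> A}) :
  (forall v, Phi (symv v) = Psi (symv v)) -> Phi =1 Psi.
Proof.
move=> PhiPsi p; rewrite [p]mpolyE !linear_sum; apply: eq_bigr => m _.
rewrite !linearZ mpolyXE_id !rmorph_prod; congr (_ *: _).
apply: eq_bigr => i _; rewrite !rmorphXn /=.
by have := PhiPsi (vbasis {:V})`_i; rewrite symv_basis => ->.
Qed.

Lemma symv_universal (A : comAlgType F) (phi : {linear V -> A}) :
  exists2 Phi : {lrmorphism SymAlg F V -> A},
    forall v, Phi (symv v) = phi v &
    forall Psi : {lrmorphism SymAlg F V -> A},
      (forall v, Psi (symv v) = phi v) -> Psi =1 Phi.
Proof.
pose Phi : SymAlg F V -> A := mmap (in_alg A) (fun i => phi (vbasis {:V})`_i).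
have PhiZ : scalable Phi.
  by move=> a p; rewrite /Phi mmapZ /= mulr_algl.
have PhiMM : monoid_morphism Phi.
  by split=> [|p q]; [exact: rmorph1 | exact: rmorphM].
pose PhiA := GRing.isZmodMorphism.Build (SymAlg F V) A Phi (mmap_is_additive _ _).
pose PhiM :=
  GRing.isMonoidMorphism.Build (SymAlg F V) A Phi PhiMM.
pose PhiS := GRing.isScalable.Build F (SymAlg F V) A *:%R Phi PhiZ.
pose PhiLR : {lrmorphism SymAlg F V -> A} := HB.pack Phi PhiA PhiM PhiS.
have PhiE v : PhiLR (symv v) = phi v.
  rewrite {2}(coord_vbasis (memvf v)) /symv !linear_sum; apply: eq_bigr => i _.
  by rewrite !linearZ /= /Phi mmapX mmap1U.
exists PhiLR => // Psi PsiE; apply: sym_morph_eq => v.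
by rewrite PsiE PhiE.
Qed.

HB.instance Definition _ g := GRing.LRMorphism.on (sym_act g).

Lemma sym_act_symv g v : sym_act g (symv v) = symv (g v).
Proof.
rewrite [in RHS](coord_vbasis (memvf v)) /sym_act {1}/symv !linear_sum.
apply: eq_bigr => i _; rewrite !linearZ /=; congr (_ *: _).
by rewrite comp_mpolyXU nth_mktuple.
Qed.

Lemma sym_actM g h p : sym_act (g * h)%g p = sym_act g (sym_act h p).
Proof.
apply: (sym_morph_eq (Phi := sym_act (g * h)%g) (Psi := sym_act g \o sym_act h)).
by move=> v; rewrite /= !sym_act_symv /= comp_lfunE.
Qed.

Lemma sym_act1 p : sym_act 1%g p = p.
Proof.
apply: (sym_morph_eq (Phi := sym_act 1%g) (Psi := idfun)).
by move=> v; rewrite /= sym_act_symv id_lfunE.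
Qed.

Lemma sym_act_inj g : injective (sym_act g).
Proof.
by apply: (can_inj (g := sym_act g^-1%g)) => p; rewrite -sym_actM mulVg sym_act1.
Qed.

Lemma symfrac_actE g a b : b != 0 ->
  symfrac_act g (a%:F / b%:F) = (sym_act g a)%:F / (sym_act g b)%:F.
Proof. exact: fracmapE (@sym_act_inj g). Qed.

Lemma symfrac_actV g v :
  symfrac_act g (symv v)%:F^-1 = (symv (g v))%:F^-1.
Proof.
have [->|v0] := eqVneq v 0; last first.
  rewrite -[_^-1]mul1r -tofrac1 symfrac_actE ?symv_eq0 //.
  by rewrite rmorph1 tofrac1 mul1r sym_act_symv.
have := symfrac_actE g 0 (oner_neq0 (SymAlg F V)).
by rewrite !linear0 tofrac0 !mul0r invr0.
Qed.

End SymmetricAlgebra.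

Arguments symC {F} V a.
Arguments symfracC {F} V a.

(* Main.v *)
From HB Require Import structures.
Require Import Defs.
From mathcomp Require Import all_boot all_order all_algebra all_fingroup.
From mathcomp Require Import all_solvable all_field.
From mathcomp Require Import mpoly ring.

Set Implicit Arguments.
Unset Strict Implicit.
Unset Printing Implicit Defensive.

Import GRing.Theory.
Local Open Scope ring_scope.

(** All six rings are computed inside the field of fractions K of S_V, by one
    counting argument.  Let H be a finite group of automorphisms of K acting
    faithfully on a ring B, and let A be a ring of invariants of B such that
    B is generated as an A-module by at most |H| elements, 1 among them.  The
    matrix of the conjugates of these generators has independent rows by
    independence of characters, so it is square and invertible; an invariant b
    has the same image under it as b times the first basis vector, hence b is
    the coefficient of 1 in itself and lies in A.  Thus B^H = A
    (invariants_of_spans).  If moreover A is generated by r elements and B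
    contains r algebraically independent ones, a count of monomials shows that
    the generators of A are independent (alg_indep_of_finite).  So
    everything rests on exhibiting few module generators.

    Let x_0, ..., x_(r-1) be a basis of V and V_i the span of the x_j with
    j < i.  The polynomial P_i(T), the product of T - v over v in V_i, is
    additive, with P_(i+1) = P_i^q - P_i(x_i)^(q-1) P_i.  Its coefficients, for
    i = r, are the Dickson invariants; g_i = P_i(x_i) is the product of the
    unitriangular orbit of x_i, and f_i, the linear coefficient of P_i divided
    by g_i, is the sum of the inverses of the elements of this orbit.  Dividing
    the Dickson invariants by the linear one gives the invariants h of R_V.
    The module generators are found as follows.
    - S_V over F[g]: x_i satisfies P_i(x_i) = g_i, of degree q^i
      (spans_sym_unitri).
    - S_V over the Dickson invariants: x_i is a root of P_r / P_i, of degree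
      q^r - q^i (spans_sym_gl).
    - R_V over F[f]: partial fractions show that passing from V_i to V_(i+1)
      takes q^i generators (spans_partial_fractions, spans_recip_unitri).
    - F[f] over F[h]: descending the flag, f_i is a root of a monic polynomial
      of degree q^(i+1) - 1 (spans_recip_gl_unitri).
    The products of these numbers are the orders of the unitriangular group
    and of the general linear group.

    For the special linear group, the product of all the g_i is the Moore
    determinant (moore_det), a semi-invariant of weight det whose (q - 1)-st
    power is, up to sign, the Dickson invariant of highest degree.  An invariant
    of the special linear group is a sum of semi-invariants of weights powers
    of det, and each of these is an invariant times a power of the Moore
    determinant, because the Dickson invariant is a prime of the polynomial ring
    of invariants (kernel_invariants).  The inverse of the Moore determinant
    plays the same role in R_V.

    Finally a maximal unipotent subgroup is unitriangular in some basis: it is a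
    p-group, and by Sylow it lies in a conjugate of the unitriangular group
    (maximal_unipotent_unitri). *)

(** * Subalgebras and their modules *)

Section SubalgebraTheory.
Variables (F K : fieldType) (c : {rmorphism F -> K}).
Implicit Types (X Y A B : K -> Prop) (s t : seq K).

Local Notation sa := (subalg c).

Definition adjoin X Y : K -> Prop := fun x => X x \/ Y x.

Lemma subalg0 X : sa X 0.
Proof. by rewrite -(rmorph0 c); apply: subalg_const. Qed.

Lemma subalg1 X : sa X 1.
Proof. by rewrite -(rmorph1 c); apply: subalg_const. Qed.

Lemma subalgN X x : sa X x -> sa X (- x).
Proof.
move=> Xx; rewrite -mulN1r -(rmorphN1 c).
by apply: subalg_mul => //; apply: subalg_const.
Qed.

Lemma subalgB X x y : sa X x -> sa X y -> sa X (x - y).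
Proof. by move=> Xx Xy; apply: subalg_add => //; apply: subalgN. Qed.

Lemma subalgX X x n : sa X x -> sa X (x ^+ n).
Proof.
move=> Xx; elim: n => [|n IHn]; first exact: subalg1.
by rewrite exprS; apply: subalg_mul.
Qed.

Lemma subalg_sum X (I : Type) (r : seq I) (P : pred I) (f : I -> K) :
  (forall i, P i -> sa X (f i)) -> sa X (\sum_(i <- r | P i) f i).
Proof.
by move=> Xf; apply: big_ind => //; [apply: subalg0 | apply: subalg_add].
Qed.

Lemma subalg_sum_mem X (I : eqType) (r : seq I) (f : I -> K) :
  (forall i, i \in r -> sa X (f i)) -> sa X (\sum_(i <- r) f i).
Proof. by move=> Xf; rewrite big_seq; apply: subalg_sum. Qed.

Lemma subalg_prod_mem X (I : eqType) (r : seq I) (f : I -> K) :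
  (forall i, i \in r -> sa X (f i)) -> sa X (\prod_(i <- r) f i).
Proof.
move=> Xf; rewrite big_seq.
by apply: big_ind => //; [apply: subalg1 | apply: subalg_mul].
Qed.

Lemma subalg_trans X Y : (forall x, X x -> sa Y x) -> forall x, sa X x -> sa Y x.
Proof.
move=> XY x; elim=> [a|y /XY //|y z _ IHy _ IHz|y z _ IHy _ IHz].
- exact: subalg_const.
- exact: subalg_add.
- exact: subalg_mul.
Qed.

Lemma subalg_adjoinl X Y x : sa X x -> sa (adjoin X Y) x.
Proof. by apply: subalg_trans => y Xy; apply: subalg_gen; left. Qed.

Lemma subalg_adjoinr X Y y : Y y -> sa (adjoin X Y) y.
Proof. by move=> Yy; apply subalg_gen; right. Qed.

Lemma subalg_fixed (sigma : {rmorphism K -> K}) X :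
    (forall a, sigma (c a) = c a) -> (forall x, X x -> sigma x = x) ->
  forall x, sa X x -> sigma x = x.
Proof.
move=> sigma_c sigmaX x; elim=> [//|//|y z _ IHy _ IHz|y z _ IHy _ IHz].
  by rewrite rmorphD IHy IHz.
by rewrite rmorphM IHy IHz.
Qed.

(** A subgroup stable under the generators is stable under the algebra that
    they generate; this is how the products of spanning elements are shown to
    stay in a span. *)
Lemma subalg_stable X (M : K -> Prop) :
    (forall x y, M x -> M y -> M (x + y)) ->
    (forall a x, M x -> M (c a * x)) ->
    (forall x y, X x -> M y -> M (x * y)) ->
  forall z m, sa X z -> M m -> M (z * m).
Proof.
move=> MD MZ MX z m Xz; elim: Xz m => [a|x Xx|x y _ IHx _ IHy|x y _ IHx _ IHy] m Mm.
- exact: MZ.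
- exact: MX.
- by rewrite mulrDl; apply: MD; [apply: IHx | apply: IHy].
- by rewrite -mulrA; apply/IHx/IHy.
Qed.

Definition span A s (z : K) : Prop :=
  exists2 a : nat -> K, (forall i, A (a i)) & z = \sum_(i < size s) a i * s`_i.

Lemma span0 X s : span (sa X) s 0.
Proof.
exists (fun=> 0) => [_|]; first exact: subalg0.
by rewrite big1 // => i _; rewrite mul0r.
Qed.

Lemma spanD X s x y : span (sa X) s x -> span (sa X) s y -> span (sa X) s (x + y).
Proof.
move=> [a Aa ->] [b Ab ->]; exists (fun i => a i + b i) => [i|].
  exact: subalg_add.
by rewrite -big_split; apply: eq_bigr => i _; rewrite mulrDl.
Qed.

Lemma spanZ X s a x : sa X a -> span (sa X) s x -> span (sa X) s (a * x).
Proof.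
move=> Xa [b Ab ->]; exists (fun i => a * b i) => [i|].
  exact: subalg_mul.
by rewrite mulr_sumr; apply: eq_bigr => i _; rewrite mulrA.
Qed.

Lemma spanB X s x y : span (sa X) s x -> span (sa X) s y -> span (sa X) s (x - y).
Proof.
move=> Ax Ay; apply: spanD => //; rewrite -mulN1r; apply: spanZ => //.
by apply: subalgN; apply: subalg1.
Qed.

Lemma span_sum X s (I : Type) (r : seq I) (P : pred I) (f : I -> K) :
  (forall i, P i -> span (sa X) s (f i)) -> span (sa X) s (\sum_(i <- r | P i) f i).
Proof. by move=> Xf; apply: big_ind => //; [apply: span0 | apply: spanD]. Qed.

Lemma span_mem X s x : x \in s -> span (sa X) s x.
Proof.
move=> sx; exists (fun i => (i == index x s)%:R) => [i|].
  by case: (_ == _); [apply: subalg1 | apply: subalg0].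
have lt_x : (index x s < size s)%N by rewrite index_mem.
rewrite (bigD1 (Ordinal lt_x)) //= eqxx mul1r nth_index // big1 ?addr0 //.
move=> i; rewrite -val_eqE /= => /negPf ->; exact: mul0r.
Qed.

Lemma span_sub X s (M : K -> Prop) :
    M 0 -> (forall x y, M x -> M y -> M (x + y)) ->
    (forall a x, sa X a -> x \in s -> M (a * x)) ->
  forall z, span (sa X) s z -> M z.
Proof.
move=> M0 MD Ms z [a Aa ->]; apply: big_ind => // i _.
by apply: Ms; rewrite ?mem_nth.
Qed.

Lemma span_tower X B s t z :
    (forall b, B b -> span (sa X) s b) -> span B t z ->
  span (sa X) [seq x * y | x <- s, y <- t] z.
Proof.
move=> Bs [b Bb ->]; apply: span_sum => i _.
apply: (span_sub (M := fun u => span _ _ (u * t`_i)) _ _ _ (Bs _ (Bb i))).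
- by rewrite mul0r; apply: span0.
- by move=> x y Mx My; rewrite mulrDl; apply: spanD.
move=> a x Aa sx; rewrite -mulrA; apply: spanZ => //; apply: span_mem.
by apply: allpairs_f => //; rewrite mem_nth.
Qed.

(** The distinguished generator 1 is what allows an invariant to be read off
    as one of its own coefficients. *)
Definition spans A B n : Prop :=
  exists s, [/\ size s = n, s`_0 = 1, (0 < n)%N,
               (forall x, x \in s -> B x) & forall z, B z -> span A s z].

Lemma spans_refl X : spans (sa X) (sa X) 1.
Proof.
exists [:: 1]; split=> // [x|z Xz]; first by rewrite inE => /eqP->; apply: subalg1.
by rewrite -[z]mulr1; apply: spanZ => //; apply: span_mem; rewrite inE.
Qed.

Lemma spans_trans X Y Z m n :
    (forall y, sa Y y -> sa Z y) ->
    spans (sa X) (sa Y) m -> spans (sa Y) (sa Z) n ->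
  spans (sa X) (sa Z) (m * n).
Proof.
move=> YZ [s [sz_s s0 m_gt0 sY Ys]] [t [sz_t t0 n_gt0 tZ Zt]].
exists [seq x * y | x <- s, y <- t]; split.
- by rewrite size_allpairs sz_s sz_t.
- move: sz_s sz_t s0 t0 m_gt0 n_gt0 {sY Ys tZ Zt}.
  case: s => [<- //|x s _]; case: t => [<- //|y t _] /= -> ->.
  by rewrite mulr1.
- by rewrite muln_gt0 m_gt0.
- move=> _ /allpairsP[[x y] /= [sx ty ->]]; apply: subalg_mul; last exact: tZ.
  exact/YZ/sY.
by move=> z /Zt; apply: span_tower.
Qed.

Lemma spans_sub A B B' n : (forall x, B' x <-> B x) -> spans A B n -> spans A B' n.
Proof.
by move=> BB [s [? ? ? sB Bs]]; exists s; split=> // [x /sB/BB|z /BB/Bs].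
Qed.

(** A root of a monic polynomial of degree n generates an extension that its
    n first powers span: the polynomial rewrites the n-th power. *)
Lemma spans_root X (p : {poly K}) y n :
    p \is monic -> size p = n.+1 -> (forall i, sa X p`_i) -> root p y ->
  spans (sa X) (sa (adjoin X (eq y))) n.
Proof.
move=> p_mon sz_p Xp py.
have n_gt0 : (0 < n)%N.
  case: n sz_p => // /eqP/size_poly1P[a a0 pa].
  by move: py; rewrite pa /root hornerC (negPf a0).
pose s := [seq y ^+ i | i <- iota 0 n].
have sE i : (i < n)%N -> y ^+ i \in s.
  by move=> lt_in; apply/mapP; exists i; rewrite ?mem_iota.
have yn : span (sa X) s (y ^+ n).
  move/eqP: py; rewrite horner_coef sz_p big_ord_recr /=.
  have -> : p`_n = 1 by move/monicP: p_mon; rewrite /lead_coef sz_p.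
  rewrite mul1r addrC => /eqP; rewrite addr_eq0 => /eqP->.
  rewrite -mulN1r; apply: spanZ; first by apply: subalgN; apply: subalg1.
  by apply: span_sum => i _; apply: spanZ => //; apply: span_mem; apply: sE.
exists s; split=> //; first by rewrite size_map size_iota.
- by rewrite (nth_map 0%N) ?size_iota // nth_iota.
- move=> _ /mapP[i _ ->]; exact/subalgX/subalg_adjoinr.
move=> z Xz; rewrite -[z]mulr1.
apply: (subalg_stable (M := span (sa X) s) _ _ _ Xz).
- exact: spanD.
- by move=> a x; apply: spanZ; apply: subalg_const.
- move=> x w [Xx|<- sw]; first by apply: spanZ; apply: subalg_gen.
  apply: (span_sub (M := fun u => span (sa X) s (y * u)) _ _ _ sw).
  + by rewrite mulr0; apply: span0.
  + by move=> u v Mu Mv; rewrite mulrDr; apply: spanD.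
  move=> a x1 Xa /mapP[i]; rewrite mem_iota add0n /= => lt_in ->.
  rewrite mulrCA -exprS; apply: spanZ => //.
  have [lt_Sin|] := ltnP i.+1 n; first by apply: span_mem; apply: sE.
  by move=> le_nSi; rewrite (_ : i.+1 = n) //; apply/eqP; rewrite eqn_leq lt_in.
by apply: span_mem; rewrite -(expr0 y); apply: sE.
Qed.

End SubalgebraTheory.

(** * Invariants of a finite set of automorphisms *)

Section Invariants.
Variables (F K : fieldType) (c : {rmorphism F -> K}).
Local Notation sa := (subalg c).

(** The relation at b0 * b minus sigma i b0 times the relation at b has lost
    its i-th term, and its j-th coefficient has been multiplied by
    sigma j b0 - sigma i b0, which is nonzero for a suitable b0. *)
Lemma characters_independent (I : eqType) (sigma : I -> {rmorphism K -> K})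
    (B : K -> Prop) (B1 : B 1) (BM : forall x y, B x -> B y -> B (x * y)) :
    (forall i j, i != j -> exists2 b, B b & sigma i b != sigma j b) ->
  forall (r : seq I) (lam : I -> K), uniq r ->
    (forall b, B b -> \sum_(i <- r) lam i * sigma i b = 0) ->
  forall i, i \in r -> lam i = 0.
Proof.
move=> dist; elim=> // i r IHr lam /andP[ri uniq_r] lam0.
have lam_r j : j \in r -> lam j = 0.
  move=> rj; have ij : i != j by apply: contraNneq ri => ->.
  have [b0 Bb0 neq_b0] := dist i j ij.
  suff /eqP : lam j * (sigma j b0 - sigma i b0) = 0.
    by rewrite mulf_eq0 subr_eq0 [sigma j _ == _]eq_sym (negPf neq_b0) orbF => /eqP.
  apply: (IHr (fun k => lam k * (sigma k b0 - sigma i b0))) => // b Bb.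
  have := lam0 _ (BM _ _ Bb0 Bb); rewrite big_cons.
  have := congr1 ( *%R (sigma i b0)) (lam0 _ Bb); rewrite big_cons mulr0.
  rewrite mulrDr mulr_sumr => E1 E2.
  have : \sum_(k <- r) lam k * (sigma k b0 - sigma i b0) * sigma k b =
     (lam i * sigma i (b0 * b) + \sum_(k <- r) lam k * sigma k (b0 * b)) -
     (sigma i b0 * (lam i * sigma i b) +
       \sum_(k <- r) sigma i b0 * (lam k * sigma k b)).
    rewrite rmorphM opprD addrACA mulrCA subrr add0r -sumrB.
    apply: eq_bigr => k _; rewrite rmorphM mulrBr mulrBl -!mulrA.
    by congr (_ - _); rewrite [in RHS]mulrCA.
  by rewrite E1 E2 subrr => ->.
move=> j; rewrite inE => /predU1P[->|]; last exact: lam_r.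
have := lam0 _ B1; rewrite big_cons rmorph1 mulr1 big_seq big1 ?addr0 //.
by move=> k /lam_r->; rewrite mul0r.
Qed.

(** If B is generated over invariants A by no more elements (1 among them)
    than there are automorphisms, then the matrix of the conjugates of these
    generators has independent rows by independence of characters, hence
    independent columns.  An invariant b of B and the first coordinate vector
    times b have the same image under it, so b is the first coordinate of
    itself and lies in A. *)
Lemma invariants_of_spans (I : finType) (sigma : I -> {rmorphism K -> K})
    (X Y : K -> Prop) n :
    (forall i x, sa X x -> sigma i x = x) ->
    (forall i j, i != j -> exists2 b, sa Y b & sigma i b != sigma j b) ->
    spans (sa X) (sa Y) n -> (n <= #|I|)%N ->
  forall b, sa Y b -> (forall i, sigma i b = b) -> sa X b.
Proof.
move=> fixX dist [s [sz_s s0 n_gt0 sY Ys]] le_nI b Yb fix_b.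
pose M := \matrix_(i < #|I|, j < n) sigma (enum_val i) s`_j.
have spanE i (z : K) (a : nat -> K) : (forall k, sa X (a k)) ->
    z = \sum_(k < size s) a k * s`_k ->
    sigma (enum_val i) z = \sum_(k < n) M i k * a k.
  move=> Xa ->; rewrite sz_s rmorph_sum; apply: eq_bigr => k _.
  by rewrite rmorphM fixX // mxE mulrC.
have freeM : row_free M.
  rewrite -kermx_eq0; apply/rowV0P => v /sub_kermxP vM.
  have v0 (i : I) : i \in enum I -> v 0 (enum_rank i) = 0.
    apply: (characters_independent (sigma := sigma) (subalg1 c Y) _ dist
      (lam := fun i => v 0 (enum_rank i)) (enum_uniq _)).
      by move=> x y; apply: subalg_mul.
    move=> z /Ys[a Xa zE]; rewrite big_enum /=.
    rewrite (reindex (@enum_val I predT)) /=; last first.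
      by apply: onW_bij; apply: enum_val_bij.
    transitivity (\sum_j \sum_k v 0 j * M j k * a k).
      apply: eq_bigr => j _; rewrite (spanE j z a) // mulr_sumr enum_valK.
      by apply: eq_bigr => k _; rewrite mulrA.
    rewrite exchange_big big1 //= => k _; rewrite -mulr_suml.
    by have := congr1 (fun w : 'rV_n => w 0 k) vM; rewrite !mxE => ->; rewrite mul0r.
  apply/rowP=> i; rewrite mxE -(enum_valK i); apply: v0; exact: mem_enum.
have freeMT : row_free M^T.
  rewrite /row_free mxrank_tr eqn_leq rank_leq_col /=.
  by move/eqP: freeM => ->.
have [a Xa bE] := Ys b Yb.
pose k0 := Ordinal n_gt0.
pose w := \row_(k < n) (a k - (k == k0)%:R * b).
have : w *m M^T = 0.
  apply/rowP=> i; rewrite !mxE.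
  transitivity (sigma (enum_val i) b - M i k0 * b).
    rewrite (spanE i b a) // (bigD1 k0) //= [in RHS](bigD1 k0) //= !mxE eqxx mul1r.
    rewrite mulrBl [a _ * _]mulrC [b * _]mulrC addrAC; congr (_ - _); congr (_ + _).
    by apply: eq_bigr => k /negPf k0'; rewrite !mxE k0' mul0r subr0 mulrC.
  by rewrite mxE /= s0 rmorph1 mul1r fix_b subrr.
move/eqP; rewrite -(mul0mx _ M^T) => /eqP/(row_free_inj freeMT).
move/rowP/(_ k0); rewrite !mxE eqxx mul1r => /eqP; rewrite subr_eq0 => /eqP <-.
exact: Xa.
Qed.

End Invariants.

(** * Algebraic independence *)

Section AlgebraicIndependence.
Variables (F K : fieldType) (c : {rmorphism F -> K}).
Local Notation sa := (subalg c).

Definition values n (z : 'I_n -> K) : K -> Prop := fun x => exists i, x = z i.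

Lemma subalg_mmap n (z : 'I_n -> K) x :
  sa (values z) x <-> exists p, x = mmap c z p.
Proof.
split=> [|[p ->]].
  elim=> [a|_ [i ->]|_ _ _ [p ->] _ [q ->]|_ _ _ [p ->] _ [q ->]].
  - by exists a%:MP; rewrite mmapC.
  - by exists 'X_i; rewrite mmapX mmap1U.
  - by exists (p + q); rewrite rmorphD.
  - by exists (p * q); rewrite rmorphM.
apply: subalg_sum => m _; apply: subalg_mul; first exact: subalg_const.
apply: subalg_prod_mem => i _; apply: subalgX.
by apply subalg_gen; exists i.
Qed.

Lemma linear_relation (T S : finType) (y : T -> K) (w : S -> K) :
    (#|S| < #|T|)%N ->
    (forall t, exists a : S -> F, y t = \sum_s c (a s) * w s) ->
  exists2 lam : T -> F, exists t, lam t != 0 & \sum_t c (lam t) * y t = 0.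
Proof.
move=> lt_ST /fin_all_exists[a yE].
pose M := \matrix_(i < #|T|, j < #|S|) a (enum_val i) (enum_val j).
have : kermx M != 0.
  rewrite kermx_eq0 /row_free neq_ltn (leq_ltn_trans _ lt_ST) //.
  exact: rank_leq_col.
case/rowV0Pn=> v /sub_kermxP vM v_neq0.
exists (fun t => v 0 (enum_rank t)).
  have /existsP[i vi] : [exists i, v 0 i != 0].
    apply: contraR v_neq0; rewrite negb_exists => /forallP v0.
    by apply/eqP/rowP=> i; rewrite mxE; apply/eqP; have := v0 i; rewrite negbK.
  by exists (enum_val i); rewrite enum_valK.
transitivity (\sum_s (\sum_t c (v 0 (enum_rank t)) * c (a t s)) * w s).
  transitivity (\sum_t \sum_s c (v 0 (enum_rank t)) * c (a t s) * w s).
    apply: eq_bigr => t _; rewrite yE mulr_sumr.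
    by apply: eq_bigr => s _; rewrite mulrA.
  by rewrite exchange_big; apply: eq_bigr => s _; rewrite mulr_suml.
rewrite big1 // => s _.
have := congr1 (fun u : 'rV_#|S| => u 0 (enum_rank s)) vM; rewrite !mxE.
rewrite (reindex (@enum_rank T)) /=; last first.
  by apply: onW_bij; apply: enum_rank_bij.
under eq_bigr => t _ do rewrite mxE !enum_rankK.
move=> vM0; under eq_bigr => t _ do rewrite -rmorphM.
by rewrite -rmorph_sum vM0 rmorph0 mul0r.
Qed.

(** Such an exponent b lies on one of the mdeg m0 hyperplanes b i = k with
    k < m0 i, each of which has M ^ (n - 1) points. *)
Lemma card_reduced n (m0 : 'X_{1..n}) M :
  (#|[pred b : {ffun 'I_n -> 'I_M} | ~~ [forall i, m0 i <= b i]]|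
     <= mdeg m0 * M ^ n.-1)%N.
Proof.
pose H (i : 'I_n) := family (fun j => [pred k : 'I_M | (j == i) ==> (k < m0 i)%N]).
have cardH i : (#|H i| <= m0 i * M ^ n.-1)%N.
  rewrite card_family foldrE big_image /=.
  rewrite (bigD1 i) //=; apply: leq_mul.
    have lt_m0 (k : 'I_M) : k \in [pred k : 'I_M | (i == i) ==> (k < m0 i)%N] ->
      (k < m0 i)%N by rewrite inE eqxx.
    rewrite cardE -(size_map val) -[leqRHS](size_iota 0).
    apply: uniq_leq_size.
      by rewrite map_inj_uniq ?enum_uniq //; apply: val_inj.
    move=> e /mapP[k]; rewrite mem_enum => /lt_m0 lt_k ->.
    by rewrite mem_iota.
  rewrite -[n in n.-1]card_ord -(cardC1 i) -prod_nat_const.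
  by apply: leq_prod => j ji; apply: (leq_trans (max_card _)); rewrite card_ord.
rewrite mdegE big_distrl /=.
apply: leq_trans (leq_sum _ (fun i _ => cardH i)).
rewrite (@leq_trans #|\bigcup_i [set b | b \in H i]|) //.
  apply: subset_leq_card; apply/subsetP=> b; rewrite inE negb_forall.
  case/existsP=> i; rewrite -ltnNge => lt_bi; apply/bigcupP; exists i => //.
  rewrite inE; apply/familyP=> j; rewrite inE; apply/implyP=> /eqP ->.
  exact: lt_bi.
elim/big_rec2: _ => [|i S k _ leSk]; first by rewrite cards0.
by rewrite (leq_trans (leq_card_setU _ _)) // cardsE leq_add2l.
Qed.

(** The relation Q expresses its leading monomial, hence each multiple of it,
    by smaller monomials; the degree does not grow because the monomial order
    is graded. *)
Lemma reduce_monomial n (z : 'I_n -> K) (Q : {mpoly F[n]}) m :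
    Q != 0 -> mmap c z Q = 0 ->
  exists2 p : {mpoly F[n]}, mmap1 z m = mmap c z p &
    forall k, k \in msupp p -> (mdeg k <= mdeg m)%N && ~~ (mlead Q <= k)%MM.
Proof.
move=> Q0 zQ; elim/(@ltmwf n): m => m IHm.
have [le_m0m|ndiv] := boolP (mlead Q <= m)%MM; last first.
  exists 'X_[m] => [|k]; first by rewrite mmapX.
  by rewrite msuppX inE => /eqP->; rewrite leqnn.
pose m1 := (m - mlead Q)%MM.
have mE : (m1 + mlead Q)%MM = m by rewrite addmC addmBA // addmC addmK.
pose Red x := exists2 p : {mpoly F[n]}, x = mmap c z p &
    forall k, k \in msupp p -> (mdeg k <= mdeg m)%N && ~~ (mlead Q <= k)%MM.
have Red0 : Red 0 by exists 0; [rewrite rmorph0 | move=> k; rewrite msupp0].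
have RedD x y : Red x -> Red y -> Red (x + y).
  move=> [p -> redp] [q -> redq]; exists (p + q); first by rewrite rmorphD.
  by move=> k /msuppD_le; rewrite mem_cat => /orP[/redp|/redq].
have RedZ a x : Red x -> Red (c a * x).
  move=> [p -> redp]; exists (a *: p); first by rewrite mmapZ.
  by move=> k /msuppZ_le/redp.
rewrite -/(Red _).
have lcQ : mleadc Q != 0 by rewrite mleadc_eq0.
have := congr1 (fun x => mmap1 z m1 * x) zQ; rewrite mulr0 /mmap.
rewrite (bigD1_seq (mlead Q)) ?mlead_supp ?msupp_uniq //= mulrDr mulrCA.
rewrite -commr_mmap1_M ?mE => [|i x]; last exact: mulrC.
move/eqP; rewrite addr_eq0 => /eqP lead_m.
have -> : mmap1 z m = c (- (mleadc Q)^-1) *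
    (mmap1 z m1 * \sum_(i <- msupp Q | i != mlead Q) c Q@_i * mmap1 z i).
  rewrite rmorphN mulNr -mulrN -lead_m mulrA -rmorphM mulVf // rmorph1.
  by rewrite mul1r.
apply: (RedZ); rewrite mulr_sumr big_seq_cond; apply: big_ind => // k.
case/andP=> Qk k_m0; rewrite mulrCA; apply: (RedZ).
rewrite -commr_mmap1_M => [|i x]; last exact: mulrC.
have lt_k : ((m1 + k)%MM < m)%O.
  by rewrite -mE ltmc_add2r Order.POrderTheory.lt_neqAle k_m0 msupp_le_mlead.
have [p -> redp] := IHm _ lt_k; exists p => // l /redp/andP[le_l ->].
by rewrite andbT (leq_trans le_l) // lemc_mdeg // Order.POrderTheory.ltW.
Qed.

(** Transcendence degree by counting: multiplication by the y_i acts on a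
    module finitely generated over F[z], so the D ^ n monomials in y with
    exponents less than D are combinations of the generators with coefficients
    of degree O(D) in z.  A relation between the z_i would leave only
    O(D ^ (n - 1)) monomials in z for this. *)
Lemma alg_indep_of_finite n (y z : 'I_n -> K) s :
    algebraically_independent c y -> span (sa (values z)) s 1 ->
    (forall i x, x \in s -> span (sa (values z)) s (y i * x)) ->
  algebraically_independent c z.
Proof.
move=> indep_y s1 ys Q zQ; apply/eqP; apply: contraT => Q0.
pose N := size s.
have spanP x : span (sa (values z)) s x ->
    exists p : 'I_N -> {mpoly F[n]}, x = \sum_k mmap c z (p k) * s`_k.
  case=> a sa_a xE.
  have /fin_all_exists[p pE] (k : 'I_N) : exists p, a k = mmap c z p.
    exact/subalg_mmap.
  by exists p; rewrite xE; apply: eq_bigr => k _; rewrite pE.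
have /fin_all_exists[P PE] (i : 'I_n) : exists P : 'I_N -> 'I_N -> {mpoly F[n]},
    forall j : 'I_N, y i * s`_j = \sum_k mmap c z (P j k) * s`_k.
  have /fin_all_exists[P PE] (j : 'I_N) : exists p : 'I_N -> {mpoly F[n]},
      y i * s`_j = \sum_k mmap c z (p k) * s`_k.
    by apply/spanP/ys; rewrite mem_nth.
  by exists P.
have [p1 p1E] := spanP _ s1.
pose d := (\max_i \max_j \max_k msize (P i j k)).+1.
have le_d i j k : (msize (P i j k) < d)%N.
  rewrite ltnS (leq_trans _ (leq_bigmax i)) // (leq_trans _ (leq_bigmax j)) //.
  exact: leq_bigmax.
pose M0 := \max_k msize (p1 k).
pose deg M x := exists2 p : 'I_N -> {mpoly F[n]},
   (forall k, msize (p k) <= M)%N & x = \sum_k mmap c z (p k) * s`_k.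
have deg1 : deg M0 1 by exists p1 => // k; apply: leq_bigmax.
have degy M x i : deg M x -> deg (M + d)%N (y i * x).
  case=> p le_pM ->; exists (fun k => \sum_j p j * P i j k) => [k|].
    rewrite (leq_trans (msize_sum _ _ _)) //; apply/bigmax_leqP => j _.
    rewrite (leq_trans (msizeM_le _ _)) // -addnS leq_add //; exact: le_d.
  under [RHS]eq_bigr => k _ do rewrite rmorph_sum mulr_suml.
  rewrite exchange_big mulr_sumr; apply: eq_bigr => j _ /=.
  rewrite mulrCA PE mulr_sumr; apply: eq_bigr => k _.
  by rewrite rmorphM mulrA.
have degXy M x i e : deg M x -> deg (M + e * d)%N (y i ^+ e * x).
  elim: e => [|e IHe] Mx; first by rewrite addn0 mul1r.
  by rewrite exprS -mulrA mulSn [(d + _)%N]addnC addnA; apply/degy/IHe.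
have deg_mon m : deg (M0 + mdeg m * d)%N (mmap1 y m).
  rewrite /mmap1 mdegE.
  elim/big_rec2: _ => [|i x k _ deg_x]; first by rewrite addn0.
  by rewrite mulnDl addnCA addnC; apply: degXy.
have degW M M' x : (M <= M')%N -> deg M x -> deg M' x.
  by move=> le_M [p le_p xE]; exists p => // k; apply: leq_trans (le_p k) _.
(* The monomials in y with exponents less than D have coefficients of degree
   less than M <= C * D, so that D only has to exceed N * mdeg m0 * C ^ (n - 1). *)
pose m0 := mlead Q; pose C := (M0 + n * d)%N.
pose D := (N * (mdeg m0 * C ^ n.-1)).+1; pose M := (M0 + n * D * d)%N.
pose T := {ffun 'I_n -> 'I_D}.
pose S0 := {ffun 'I_n -> 'I_M}.
pose S := ('I_N * {b : S0 | ~~ [forall i, m0 i <= b i]%N})%type.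
pose mon B (t : {ffun 'I_n -> 'I_B}) : 'X_{1..n} := [multinom (t i : nat) | i < n].
have card_ST : (#|{: S}| < #|{: T}|)%N.
  rewrite card_prod card_sig card_ffun !card_ord.
  apply: (@leq_ltn_trans (N * (mdeg m0 * M ^ n.-1))).
    by rewrite leq_mul2l card_reduced orbT.
  apply: (@leq_ltn_trans (N * (mdeg m0 * (C * D) ^ n.-1))).
    rewrite !leq_mul2l; apply/orP; right; apply/orP; right.
    case: n.-1 => // e; rewrite leq_exp2r // /M /C mulnDl leq_add //.
      by rewrite leq_pmulr.
    by rewrite mulnAC.
  rewrite expnMn !mulnA.
  have [n0|n_gt0] := posnP n.
    have -> : mdeg m0 = 0%N.
      rewrite mdegE big1 // => i _.
      by move/eqP: n0; rewrite -leqn0 leqNgt (leq_ltn_trans _ (ltn_ord i)).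
    by rewrite !(mul0n, muln0) expn_gt0.
  by rewrite -[in ltnRHS](prednK n_gt0) expnS ltn_mul2r expn_gt0 /= /D ltnS mulnA.
have [t|lam [t0 lam_t0] lam0] :=
    @linear_relation T S (fun t => mmap1 y (mon D t))
       (fun s' => s`_(s'.1) * mmap1 z (mon M (val s'.2))) card_ST.
- have : deg M (mmap1 y (mon D t)).
    apply: degW (deg_mon _); rewrite /M leq_add2l leq_mul2r.
    apply/orP; right; rewrite mdegE -[n in (n * D)%N]card_ord -sum_nat_const.
    by apply: leq_sum => i _; rewrite mnmE ltnW.
  case=> p le_pM ->.
  pose Comb x := exists a : S -> F,
    x = \sum_s' c (a s') * (s`_(s'.1) * mmap1 z (mon M (val s'.2))).
  rewrite -/(Comb _).
  have Comb0 : Comb 0.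
    by exists (fun=> 0); rewrite big1 // => i _; rewrite rmorph0 mul0r.
  have CombD x x' : Comb x -> Comb x' -> Comb (x + x').
    move=> [a ->] [b ->]; exists (fun i => a i + b i); rewrite -big_split.
    by apply: eq_bigr => i _; rewrite rmorphD mulrDl.
  have CombZ a x : Comb x -> Comb (c a * x).
    move=> [b ->]; exists (fun i => a * b i); rewrite mulr_sumr.
    by apply: eq_bigr => i _; rewrite rmorphM mulrA.
  apply: big_ind => // k _; rewrite /mmap mulr_suml big_seq.
  apply: big_ind => // m pm; rewrite -mulrA; apply: (CombZ).
  have [p' -> redp'] := reduce_monomial m Q0 zQ.
  rewrite /mmap mulr_suml big_seq.
  apply: big_ind => // m' /redp'/andP[le_m' ndiv]; rewrite -mulrA; apply: (CombZ).
  have lt_m' i : (m' i < M)%N.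
    apply: leq_ltn_trans (_ : (mdeg m' < M)%N).
      by rewrite mdegE (bigD1 i) //= leq_addr.
    exact: leq_ltn_trans le_m' (leq_trans (msize_mdeg_lt pm) (le_pM k)).
  pose b : S0 := [ffun i => Ordinal (lt_m' i)].
  have monb : mon M b = m' by apply/mnmP=> i; rewrite mnmE ffunE.
  have b_red : ~~ [forall i, m0 i <= b i]%N.
    apply: contra ndiv => /forallP le_m0; apply/mnm_lepP=> i.
    by have := le_m0 i; rewrite ffunE.
  pose s0 : S := (k, exist _ b b_red).
  exists (fun s1 => (s1 == s0)%:R).
  rewrite (bigD1 s0) //= eqxx rmorph1 mul1r monb.
  rewrite big1 ?addr0 1?mulrC // => s2 /negPf ->.
  by rewrite rmorph0 mul0r.
have := indep_y (\sum_t lam t *: 'X_[mon D t]).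
rewrite rmorph_sum /=; under eq_bigr => t _ do rewrite mmapZ mmapX.
move=> /(_ lam0)/(congr1 (mcoeff (mon D t0))).
rewrite linear_sum mcoeff0 (bigD1 t0) //= mcoeffZ mcoeffX eqxx mulr1 big1 ?addr0.
  by move=> lam_t00; rewrite lam_t00 eqxx in lam_t0.
move=> t t_t0; rewrite mcoeffZ mcoeffX; case: eqP => [mon_t|]; last first.
  by rewrite mulr0.
case/eqP: t_t0; apply/ffunP=> i; apply: val_inj.
by have := congr1 (fun m : 'X_{1..n} => m i) mon_t; rewrite !mnmE.
Qed.

End AlgebraicIndependence.

(** * Semi-invariants *)

Section Divisibility.
Variables (F : fieldType) (n : nat) (i0 : 'I_n).
Local Notation kill := (mmap (@mpolyC n F) (fun i => if i == i0 then 0 else 'X_i)).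

Lemma mpoly_split_var (p : {mpoly F[n]}) : exists q, p = kill p + q * 'X_i0.
Proof.
pose D p := exists q, p = kill p + q * 'X_i0; rewrite -/(D p).
have DC a : D a%:MP by exists 0; rewrite mmapC mul0r addr0.
have DX i : D 'X_i.
  rewrite /D mmapX mmap1U; case: eqP => [->|_]; last first.
    by exists 0; rewrite mul0r addr0.
  by exists 1; rewrite mul1r add0r.
have DD p1 p2 : D p1 -> D p2 -> D (p1 + p2).
  move=> [q1 E1] [q2 E2]; exists (q1 + q2).
  by rewrite rmorphD mulrDl addrACA -E1 -E2.
have DM p1 p2 : D p1 -> D p2 -> D (p1 * p2).
  move=> [q1 E1] [q2 E2]; exists (q1 * p2 + kill p1 * q2); rewrite rmorphM.
  rewrite {1}E1 mulrDl {1}E2; ring.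
rewrite [p]mpolyE; apply: big_ind => [||m _]; first by rewrite -(mpolyC0 n F).
  exact: DD.
rewrite -mul_mpolyC; apply: (DM) => //; rewrite mpolyXE_id.
apply: big_ind => [||i _]; [exact: DC 1 | exact: DM |].
elim: (m i) => [|e IHe]; first exact: DC 1.
by rewrite exprS; apply: DM.
Qed.

(** Setting the variable to 0 is a morphism to an integral domain. *)
Lemma mpoly_var_dvd (p q : {mpoly F[n]}) k e :
  (0 < e)%N -> p ^+ k = q * 'X_i0 ^+ e -> exists p', p = p' * 'X_i0.
Proof.
move=> e_gt0 pk; have [q' pE] := mpoly_split_var p; exists q'.
rewrite {1}pE; suff -> : kill p = 0 by rewrite add0r.
have := congr1 (mmap (@mpolyC n F) (fun i => if i == i0 then 0 else 'X_i)) pk.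
rewrite !rmorphXn rmorphM rmorphXn /= mmapX mmap1U eqxx expr0n.
rewrite eqn0Ngt e_gt0 mulr0 => /eqP; rewrite expf_eq0 => /andP[_ /eqP].
by [].
Qed.

End Divisibility.

Section SemiInvariants.
Variables (F : finFieldType) (K : fieldType) (c : {rmorphism F -> K}).
Local Notation sa := (subalg c).
Local Notation e := #|F|.-1.

Lemma finField_card_gt1 : (0 < e)%N.
Proof. by rewrite -ltnS prednK ?finRing_gt1 // ltnW // finRing_gt1. Qed.

Lemma expf_card_unit (a : F) : a != 0 -> a ^+ e = 1.
Proof.
move=> a0; apply: (mulfI a0); rewrite mulr1 -exprS prednK ?expf_card //.
by rewrite ltnW // finRing_gt1.
Qed.

Lemma sum_powers (a : F) : a != 0 -> \sum_(j < e) a ^+ j = - (a == 1)%:R.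
Proof.
move=> a0; have [->|a1] := eqVneq a 1.
  under eq_bigr => j _ do rewrite expr1n.
  rewrite sumr_const card_ord; apply: (addrI 1); rewrite subrr -mulrS.
  rewrite prednK; last by rewrite ltnW // finRing_gt1.
  by rewrite -FinRing.zmodXgE -cardsT expg_cardG ?inE.
rewrite oppr0; apply/eqP; have := subrX1 a e; rewrite expf_card_unit // subrr.
by move/esym/eqP; rewrite mulf_eq0 subr_eq0 (negPf a1).
Qed.

Variables (G : finGroupType) (sigma : G -> {rmorphism K -> K}) (chi : G -> F).
Hypothesis sigmaM : forall g h x, sigma (g * h)%g x = sigma g (sigma h x).
Hypothesis sigma_c : forall g a, sigma g (c a) = c a.
Hypothesis chiM : forall g h, chi (g * h)%g = chi g * chi h.
Hypothesis chi_neq0 : forall g, chi g != 0.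
Hypothesis chi_onto : forall a, a != 0 -> exists g, chi g = a.

Variables (Y : K -> Prop) (n : nat) (z : 'I_n -> K) (i0 : 'I_n) (eta : K) (u : F).
Hypothesis Ystable : forall g y, sa Y y -> sa Y (sigma g y).
Hypothesis indep_z : algebraically_independent c z.
Hypothesis fixedY : forall b, sa Y b -> (forall g, sigma g b = b) -> sa (values z) b.
Hypothesis Y_eta : sa Y eta.
Hypothesis eta_neq0 : eta != 0.
Hypothesis u_neq0 : u != 0.
Hypothesis sigma_eta : forall g, sigma g eta = c (chi g) * eta.
Hypothesis z_eta : z i0 = c u * eta ^+ e.

Local Notation z' := (fun i => if i == i0 then eta else z i).

Lemma values_sub_eta x : sa (values z) x -> sa (values z') x.
Proof.
apply: subalg_trans => _ [i ->]; have [->|i_i0] := eqVneq i i0.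
  rewrite z_eta; apply: subalg_mul; first exact: subalg_const.
  by apply: subalgX; apply subalg_gen; exists i0; rewrite eqxx.
by apply subalg_gen; exists i; rewrite (negPf i_i0).
Qed.

(** If p has weight chi ^- j with 0 < j < q - 1, then p * eta ^ j and p ^ (q - 1)
    are invariants; as the prime z_(i0) divides the (q - 1)-st power of the
    first one, it divides the first one, so that p is an invariant times
    eta ^ (q - 1 - j). *)
Lemma semi_invariant p j : (j < e)%N -> sa Y p ->
  (forall g, c (chi g) ^+ j * sigma g p = p) -> sa (values z') p.
Proof.
move=> lt_je Yp wp.
have c0 g : c (chi g) != 0 by rewrite fmorph_eq0.
have fix_a g : sigma g (p * eta ^+ j) = p * eta ^+ j.
  rewrite rmorphM rmorphXn /= sigma_eta exprMn mulrA; congr (_ * _).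
  by rewrite mulrC wp.
have Za : sa (values z) (p * eta ^+ j).
  by apply: fixedY => //; apply: subalg_mul => //; apply: subalgX.
have [j0|j_gt0] := posnP j.
  by apply: values_sub_eta; move: Za; rewrite j0 mulr1.
have fix_b g : sigma g (p ^+ e) = p ^+ e.
  have chi_e : c (chi g) ^+ e = 1 by rewrite -rmorphXn expf_card_unit ?rmorph1.
  rewrite rmorphXn /= -[p in RHS](wp g) exprMn -exprM mulnC exprM chi_e.
  by rewrite expr1n mul1r.
have Zb : sa (values z) (p ^+ e) by apply: fixedY => //; apply: subalgX.
have [A aE] := (subalg_mmap c z _).1 Za.
have [B bE] := (subalg_mmap c z _).1 Zb.
have AB : A ^+ e = (u ^- j)%:MP * B * 'X_i0 ^+ j.
  apply/eqP; rewrite -subr_eq0; apply/eqP/indep_z.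
  rewrite rmorphB !rmorphM !rmorphXn /= -aE -bE mmapC mmapX mmap1U z_eta.
  have cu : c (u ^- j) * c u ^+ j = 1.
    by rewrite -rmorphXn -rmorphM mulVf ?rmorph1 // expf_neq0.
  rewrite !exprMn -!exprM [(e * j)%N]mulnC mulrACA cu mul1r.
  by rewrite subrr.
have [A' A'E] := mpoly_var_dvd j_gt0 AB.
have -> : p = mmap c z A' * c u * eta ^+ (e - j).
  apply: (mulIf (expf_neq0 j eta_neq0)); rewrite aE A'E rmorphM /= mmapX mmap1U.
  by rewrite z_eta -!mulrA -exprD subnK // ltnW.
apply: subalg_mul; last first.
  by apply: subalgX; apply subalg_gen; exists i0; rewrite eqxx.
apply: subalg_mul; last exact: subalg_const.
by apply: values_sub_eta; apply/subalg_mmap; exists A'.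
Qed.

(** An invariant b of the kernel of chi is, up to sign, the sum of its
    projections to the weight spaces. *)
Lemma kernel_invariants b : sa Y b ->
  (forall g, chi g = 1 -> sigma g b = b) -> sa (values z') b.
Proof.
move=> Yb fix_b.
have /fin_all_exists[d chi_d] (a : F) : exists g, a != 0 -> chi g = a.
  have [->|/chi_onto[g gE]] := eqVneq a 0; first by exists 1%g.
  by exists g.
have sigma_chi g h : chi g = chi h -> sigma g b = sigma h b.
  move=> chi_gh; rewrite -(mulKVg h g) sigmaM fix_b //.
  by apply: (mulfI (chi_neq0 h)); rewrite -chiM mulKVg mulr1.
pose p j := \sum_(a | a != 0) c a ^+ j * sigma (d a) b.
have -> : b = - \sum_(j < e) p j.
  transitivity (- \sum_(a | a != 0) c (- (a == 1)%:R) * sigma (d a) b).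
    rewrite (bigD1 1) ?oner_neq0 //= eqxx rmorphN1 mulN1r.
    rewrite fix_b ?chi_d ?oner_neq0 // big1 ?addr0 ?opprK // => a /andP[_ /negPf->].
    by rewrite oppr0 rmorph0 mul0r.
  rewrite exchange_big; congr (- _); apply: eq_bigr => a a0.
  rewrite -mulr_suml -sum_powers // rmorph_sum.
  by under eq_bigr => j _ do rewrite rmorphXn.
apply: subalgN; apply: subalg_sum => j _.
apply: (@semi_invariant _ j) => // [|g].
  apply: subalg_sum => a _; apply: subalg_mul; last exact: Ystable.
  by apply: subalgX; apply: subalg_const.
rewrite /p rmorph_sum mulr_sumr [RHS](reindex (fun a => chi g * a)) /=; last first.
  apply: onW_bij; exists (fun a => (chi g)^-1 * a) => a.
    by rewrite mulrA mulVf ?mul1r.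
  by rewrite mulrA divff ?mul1r.
apply: eq_big => [a|a a0]; first by rewrite mulf_eq0 negb_or chi_neq0.
rewrite rmorphM rmorphXn /= sigma_c mulrA rmorphM exprMn; congr (_ * _).
by rewrite -sigmaM; apply: sigma_chi; rewrite chiM !chi_d // mulf_neq0.
Qed.

End SemiInvariants.

(** * The additive polynomials of a flag *)

Section Flag.
Variables (F : finFieldType) (K : fieldType) (c : {rmorphism F -> K}).
Variables (r : nat) (x : nat -> K).
Local Notation q := #|F|.

Lemma card_F_gt0 : (0 < q)%N.
Proof. by rewrite ltnW // finNzRing_gt1. Qed.

Lemma natr_card_F : q%:R = 0 :> K.
Proof.
have /(congr1 c) : q%:R = 0 :> F by rewrite -FinRing.zmodXgE -cardsT expg_cardG ?inE.
by rewrite rmorph_nat rmorph0.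
Qed.

Lemma pchar_card_F : [pchar K].-nat q.
Proof.
have [p p_pr charFp] := finPcharP F.
have charKp : p \in [pchar K] by rewrite (fmorph_pchar c).
rewrite (eq_pnat _ (pcharf_eq charKp)) -cardsT.
have := fin_ring_pchar_abelem charFp; rewrite /is_true.
by move/abelem_pgroup.
Qed.

Lemma frobeniusD (y z : K) : (y + z) ^+ q = y ^+ q + z ^+ q.
Proof. exact: exprDn_pchar pchar_card_F. Qed.

Lemma frobenius0 : 0 ^+ q = 0 :> K.
Proof. by rewrite expr0n eqn0Ngt card_F_gt0. Qed.

Lemma frobenius_sum (I : Type) (s : seq I) (f : I -> K) :
  (\sum_(i <- s) f i) ^+ q = \sum_(i <- s) f i ^+ q.
Proof. exact: (big_morph _ frobeniusD frobenius0). Qed.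

Lemma frobenius_scalar a n : c a ^+ (q ^ n) = c a.
Proof.
elim: n => [|n IHn]; first by rewrite expr1.
by rewrite expnS exprM -rmorphXn expf_card IHn.
Qed.

Lemma frobenius_iterD (y z : K) n : (y + z) ^+ (q ^ n) = y ^+ (q ^ n) + z ^+ (q ^ n).
Proof.
elim: n y z => [|n IHn] y z; first by rewrite !expr1.
by rewrite expnS !exprM frobeniusD IHn.
Qed.

(** The span V_i of the x_j with j < i is kept as a list, so that products and
    sums over it are big operators. *)
Fixpoint flag i : seq K :=
  if i is j.+1 then [seq v + c a * x j | v <- flag j, a <- enum F] else [:: 0].

Lemma flagS i v a : v \in flag i -> v + c a * x i \in flag i.+1.
Proof. by move=> iv; apply/allpairsP; exists (v, a); rewrite mem_enum. Qed.

Lemma flagSP i w :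
  reflect (exists v a, v \in flag i /\ w = v + c a * x i) (w \in flag i.+1).
Proof.
apply: (iffP allpairsP) => [[[v a] [/= iv _ ->]]|[v [a [iv ->]]]].
  by exists v, a.
by exists (v, a); rewrite mem_enum.
Qed.

Lemma flag_mono i v : v \in flag i -> v \in flag i.+1.
Proof. by move/(flagS 0); rewrite rmorph0 mul0r addr0. Qed.

Lemma flag_le i j v : (i <= j)%N -> v \in flag i -> v \in flag j.
Proof.
move/subnK <-; elim: (j - i)%N => [|k IHk] // iv.
by rewrite addSn; apply/flag_mono/IHk.
Qed.

Lemma flag0 i : 0 \in flag i.
Proof. by apply: (flag_le (leq0n i)); rewrite inE. Qed.

Lemma flagD i v w : v \in flag i -> w \in flag i -> v + w \in flag i.
Proof.
elim: i v w => [|i IHi] v w; first by rewrite !inE => /eqP-> /eqP->; rewrite addr0.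
move=> /flagSP[v' [a [iv ->]]] /flagSP[w' [b [iw ->]]].
by rewrite addrACA -mulrDl -rmorphD; apply/flagS/IHi.
Qed.

Lemma flagZ i a v : v \in flag i -> c a * v \in flag i.
Proof.
elim: i v => [|i IHi] v; first by rewrite !inE => /eqP->; rewrite mulr0.
move=> /flagSP[v' [b [iv ->]]].
by rewrite mulrDr mulrA -rmorphM; apply/flagS/IHi.
Qed.

Lemma flagN i v : v \in flag i -> - v \in flag i.
Proof. by rewrite -mulN1r -(rmorphN1 c); apply: flagZ. Qed.

Lemma flagB i v w : v \in flag i -> w \in flag i -> v - w \in flag i.
Proof. by move=> iv iw; apply: flagD => //; apply: flagN. Qed.

Lemma flag_gen i : x i \in flag i.+1.
Proof. by rewrite -[x i]mul1r -(rmorph1 c) -[_ * _]add0r; apply/flagS/flag0. Qed.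

Lemma size_flag i : size (flag i) = (q ^ i)%N.
Proof.
elim: i => // i IHi; rewrite size_allpairs IHi -cardE expnSr.
by [].
Qed.

Hypothesis x_free : forall i, (i < r)%N -> x i \notin flag i.

Lemma flag_uniq i : (i <= r)%N -> uniq (flag i).
Proof.
elim: i => // i IHi lt_ir.
apply: allpairs_uniq => [||p p']; [exact/IHi/ltnW | exact: enum_uniq |].
move=> /allpairsP[[v a] /= [iv _ ->]] /allpairsP[[w b] /= [iw _ ->]] /= E.
have [ab|ab] := eqVneq a b; first by move: E; rewrite ab => /addIr->.
case/negP: (x_free lt_ir); have cab : c (a - b) != 0 by rewrite fmorph_eq0 subr_eq0.
have -> : x i = c (a - b)^-1 * (w - v); last by apply/flagZ/flagB.
rewrite fmorphV; apply: (mulfI cab); rewrite mulVKf // rmorphB mulrBl.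
have -> : c a * x i = w + c b * x i - v by rewrite -E addrAC subrr add0r.
by rewrite addrAC addrK.
Qed.

(** The coefficient of T ^ (q ^ j) in the polynomial P_i with roots V_i,
    defined by P_(i+1) = P_i ^ q - P_i(x_i) ^ (q - 1) P_i.  For i = r these are
    the Dickson invariants. *)
Fixpoint dickson i : nat -> K :=
  if i is i'.+1 then
    let w := (\sum_(j < i) dickson i' j * x i' ^+ (q ^ j)) ^+ q.-1 in
    fun j => (if j is j'.+1 then dickson i' j' ^+ q else 0) - w * dickson i' j
  else fun j => (j == 0%N)%:R.

Definition addpoly i (y : K) : K := \sum_(j < i.+1) dickson i j * y ^+ (q ^ j).

(** The product of the orbit of x_i under the unitriangular group, by
    addpoly_prod. *)
Definition orbprod i : K := addpoly i (x i).

Lemma dicksonS0 i : dickson i.+1 0 = - (orbprod i ^+ q.-1 * dickson i 0).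
Proof. by rewrite /= sub0r. Qed.

Lemma dicksonSS i j :
  dickson i.+1 j.+1 = dickson i j ^+ q - orbprod i ^+ q.-1 * dickson i j.+1.
Proof. by []. Qed.

Lemma dickson_gt i j : (i < j)%N -> dickson i j = 0.
Proof.
elim: i j => [|i IHi] [|j] //; rewrite ltnS => lt_ij.
by rewrite dicksonSS !IHi ?frobenius0 ?mulr0 ?subr0 // ltnW.
Qed.

Lemma dickson_diag i : dickson i i = 1.
Proof. by elim: i => // i IHi; rewrite dicksonSS IHi expr1n dickson_gt // mulr0 subr0. Qed.

Lemma addpolyS i y : addpoly i.+1 y = addpoly i y ^+ q - orbprod i ^+ q.-1 * addpoly i y.
Proof.
rewrite {1}/addpoly big_ord_recl dicksonS0 expn0 expr1.
have -> : \sum_(j < i.+1) dickson i.+1 (lift ord0 j) * y ^+ (q ^ lift ord0 j) =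
    addpoly i y ^+ q -
    orbprod i ^+ q.-1 * \sum_(j < i.+1) dickson i j.+1 * y ^+ (q ^ j.+1).
  rewrite frobenius_sum mulr_sumr -sumrB; apply: eq_bigr => j _.
  by rewrite lift0 dicksonSS mulrBl exprMn -exprM -expnSr mulrA.
have -> : addpoly i y =
    dickson i 0 * y + \sum_(j < i.+1) dickson i j.+1 * y ^+ (q ^ j.+1).
  rewrite /addpoly big_ord_recl expr1; congr (_ + _).
  by rewrite big_ord_recr /= dickson_gt // mul0r addr0.
ring.
Qed.

Lemma addpolyD i y z : addpoly i (y + z) = addpoly i y + addpoly i z.
Proof.
by rewrite -big_split; apply: eq_bigr => j _; rewrite frobenius_iterD mulrDr.
Qed.

Lemma addpolyZ i a y : addpoly i (c a * y) = c a * addpoly i y.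
Proof.
rewrite mulr_sumr; apply: eq_bigr => j _.
by rewrite exprMn frobenius_scalar mulrCA.
Qed.

(** P_(i+1) vanishes where P_i does, and at x_i because g ^ q - g ^ (q - 1) g = 0
    for g = P_i(x_i); additivity does the rest. *)
Lemma addpoly_flag i v : v \in flag i -> addpoly i v = 0.
Proof.
elim: i v => [|i IHi] v.
  by rewrite inE => /eqP->; rewrite /addpoly big_ord1 expr1 mulr0.
case/flagSP=> w [a [/IHi w0 ->]].
rewrite addpolyD addpolyZ !addpolyS w0 frobenius0 mulr0 subr0 add0r -/(orbprod i).
by rewrite -exprSr prednK ?card_F_gt0 // subrr mulr0.
Qed.

Definition fpoly i : {poly K} := \sum_(j < i.+1) dickson i j *: 'X^(q ^ j).

Lemma horner_fpoly i y : (fpoly i).[y] = addpoly i y.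
Proof. by rewrite horner_sum; apply: eq_bigr => j _; rewrite hornerZ hornerXn. Qed.

Lemma fpoly_lead i : (size (fpoly i) = (q ^ i).+1) /\ fpoly i \is monic.
Proof.
have sz_lt : (size (\sum_(j < i) dickson i j *: 'X^(q ^ j))%R <= q ^ i)%N.
  apply: (leq_trans (size_sum _ _ _)); apply/bigmax_leqP => j _.
  rewrite (leq_trans (size_scale_leq _ _)) // size_polyXn.
  by rewrite ltn_exp2l ?finNzRing_gt1.
rewrite /fpoly big_ord_recr /= dickson_diag scale1r addrC monicE.
split; first by rewrite size_polyDl size_polyXn // ltnS.
by rewrite lead_coefDl ?lead_coefXn // size_polyXn ltnS.
Qed.

Lemma coef_fpoly_pred (A : K -> Prop) i : A 0 -> (forall j, A (dickson i j)) ->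
  (forall y z, A y -> A z -> A (y + z)) -> forall k, A (fpoly i)`_k.
Proof.
move=> A0 Akk AD k; rewrite coef_sum; apply: big_ind => // j _.
rewrite coefZ coefXn; case: (_ == _); rewrite ?mulr1 ?mulr0 //; exact: Akk.
Qed.

(** P_i is monic of degree q ^ i and has q ^ i distinct roots. *)
Lemma fpoly_prod i : (i <= r)%N -> fpoly i = \prod_(v <- flag i) ('X - v%:P).
Proof.
move=> le_ir; have [sz_f mon_f] := fpoly_lead i.
rewrite [LHS](all_roots_prod_XsubC (rs := flag i)).
- by rewrite (monicP mon_f) scale1r.
- by rewrite size_flag.
- by apply/allP=> v iv; rewrite /root horner_fpoly addpoly_flag.
by rewrite uniq_rootsE flag_uniq.
Qed.

Lemma addpoly_prod i y : (i <= r)%N -> addpoly i y = \prod_(v <- flag i) (y - v).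
Proof.
move=> le_ir; rewrite -horner_fpoly fpoly_prod // horner_prod.
by apply: eq_bigr => v _; rewrite hornerXsubC.
Qed.

Lemma orbprod_neq0 i : (i < r)%N -> orbprod i != 0.
Proof.
move=> lt_ir; apply: contra (x_free lt_ir).
by rewrite /orbprod -horner_fpoly fpoly_prod 1?ltnW // -/(root _ _) root_prod_XsubC.
Qed.

Definition orbprods i : K := \prod_(j < i) orbprod j.

Lemma orbprods_neq0 i : (i <= r)%N -> orbprods i != 0.
Proof.
move=> le_ir; apply/prodf_neq0 => j _; apply: orbprod_neq0.
exact: leq_trans (ltn_ord j) le_ir.
Qed.

Lemma dickson0E i : dickson i 0 = (-1) ^+ i * orbprods i ^+ q.-1.
Proof.
elim: i => [|i IHi]; first by rewrite /orbprods big_ord0 expr1n mulr1.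
rewrite dicksonS0 IHi /orbprods big_ord_recr /= exprMn exprS mulN1r mulNr.
by congr (- _); rewrite mulrCA; congr (_ * _); rewrite mulrC.
Qed.

Lemma dickson0_neq0 i : (i <= r)%N -> dickson i 0 != 0.
Proof.
by move=> le_ir; rewrite dickson0E mulf_neq0 ?expf_neq0 ?oppr_eq0 ?oner_neq0 ?orbprods_neq0.
Qed.

(** The sum of the inverses of the orbit of x_i, by rorbsum_sum. *)
Definition rorbsum i : K := dickson i 0 / orbprod i.

Lemma deriv_fpoly i : (fpoly i)^`() = (dickson i 0)%:P.
Proof.
rewrite /fpoly raddf_sum big_ord_recl big1 => [|j _].
  by rewrite addr0 /= derivZ expn0 derivX alg_polyC.
rewrite /= derivZ derivXn /bump expnS -mulr_natl natrM -polyC_natr natr_card_F.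
by rewrite polyC0 !mul0r scaler0.
Qed.

(** Both sides are the logarithmic derivative of P_i at x_i, since the derivative
    of an additive polynomial is its linear coefficient. *)
Lemma rorbsum_sum i : (i < r)%N -> rorbsum i = \sum_(v <- flag i) (x i - v)^-1.
Proof.
move=> lt_ir; have le_ir := ltnW lt_ir.
have log_deriv (s : seq K) : x i \notin s ->
    (\prod_(v <- s) ('X - v%:P))^`().[x i] =
    (\prod_(v <- s) (x i - v)) * \sum_(v <- s) (x i - v)^-1.
  elim: s => [|v s IHs]; first by rewrite !big_nil derivC hornerC mulr0.
  rewrite inE negb_or => /andP[xv xs]; rewrite !big_cons derivM hornerD !hornerM.
  rewrite IHs // derivXsubC hornerC mul1r hornerXsubC horner_prod.
  under eq_bigr => w _ do rewrite hornerXsubC.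
  by rewrite mulrDr mulrAC divff ?subr_eq0 // mul1r mulrA.
apply: (mulfI (orbprod_neq0 lt_ir)); rewrite /rorbsum mulrC divfK ?orbprod_neq0 //.
by rewrite /orbprod addpoly_prod // -log_deriv ?x_free // -fpoly_prod //
  deriv_fpoly hornerC.
Qed.

(** The coefficients of P_i normalized to have linear coefficient 1, that is,
    up to sign, elementary symmetric functions of the inverses of the nonzero
    vectors of V_i. *)
Definition rdickson i j : K := dickson i j / dickson i 0.

Lemma rdickson0 i : (i <= r)%N -> rdickson i 0 = 1.
Proof. by move=> le_ir; rewrite /rdickson divff ?dickson0_neq0. Qed.

Lemma rdickson_gt i j : (i < j)%N -> rdickson i j = 0.
Proof. by move=> lt_ij; rewrite /rdickson dickson_gt ?mul0r. Qed.

Lemma rdickson_orbprods : rdickson r r = (-1) ^+ r * (orbprods r)^-1 ^+ q.-1.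
Proof.
rewrite /rdickson dickson_diag mul1r dickson0E invfM exprVn; congr (_ * _).
by rewrite -exprVn invrN1.
Qed.

(** After normalization the recursion involves the flag only through rorbsum i,
    so that the rdickson i j are polynomials in the rorbsum k. *)
Lemma rdicksonSS i j : (i < r)%N ->
  rdickson i.+1 j.+1 = rdickson i j.+1 - rorbsum i ^+ q.-1 * rdickson i j ^+ q.
Proof.
move=> lt_ir; have le_ir := ltnW lt_ir.
have k0 := dickson0_neq0 le_ir.
have w0 : orbprod i ^+ q.-1 != 0 by rewrite expf_neq0 ?orbprod_neq0.
rewrite /rdickson dicksonS0 dicksonSS /rorbsum !expr_div_n.
have -> : dickson i 0 ^+ q = dickson i 0 * dickson i 0 ^+ q.-1.
  by rewrite -exprS prednK ?card_F_gt0.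
field.
by rewrite oppr_eq0 mulf_neq0 // k0 w0 expf_neq0.
Qed.

End Flag.

(** * Generation of S and R over rings of invariants *)

Section Towers.
Variables (F : finFieldType) (K : fieldType) (c : {rmorphism F -> K}).
Variables (r : nat) (x : nat -> K).
Hypothesis x_free : forall i, (i < r)%N -> x i \notin flag c x i.

Local Notation sa := (subalg c).
Local Notation q := #|F|.
Local Notation flag := (flag c x).
Local Notation dickson := (dickson F x).
Local Notation orbprod := (orbprod F x).
Local Notation rorbsum := (rorbsum F x).
Local Notation rdickson := (rdickson F x).
Local Notation addpoly := (addpoly F x).
Local Notation fpoly := (fpoly F x).

Lemma subalg_equiv (X Y : K -> Prop) :
    (forall z, X z -> sa Y z) -> (forall z, Y z -> sa X z) ->
  forall z, sa X z <-> sa Y z.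
Proof. by move=> XY YX z; split; apply: subalg_trans. Qed.

(** One step of a tower: Y and Z are the elements adjoined to X before and after
    the step, and W generates the step. *)
Lemma spans_step (X Y Z W : K -> Prop) m n :
    spans (sa X) (sa (adjoin X Y)) m ->
    spans (sa (adjoin X Y)) (sa (adjoin (adjoin X Y) W)) n ->
    (forall z, Y z -> Z z) -> (forall z, W z -> sa (adjoin X Z) z) ->
    (forall z, Z z -> sa (adjoin (adjoin X Y) W) z) ->
  spans (sa X) (sa (adjoin X Z)) (m * n).
Proof.
move=> XY XYW YZ WZ ZW.
have XYZ z : adjoin X Y z -> sa (adjoin X Z) z.
  by case=> [Xz|/YZ Zz]; [apply: subalg_adjoinl; apply: subalg_gen
                         | apply: subalg_adjoinr].
apply: spans_trans XY _ => [z|]; first exact: (subalg_trans XYZ).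
apply: spans_sub XYW; apply: subalg_equiv => z.
  by case=> [Xz|/ZW//]; do 2 apply: subalg_adjoinl; apply: subalg_gen.
by case=> [/XYZ|/WZ].
Qed.

Lemma spans_adjoin0 (X Y : K -> Prop) :
  (forall z, Y z -> sa X z) -> spans (sa X) (sa (adjoin X Y)) 1.
Proof.
move=> YX; apply: (spans_sub (B := sa X)); last exact: spans_refl.
apply: subalg_equiv => z; last by move=> Xz; apply: subalg_adjoinl; apply: subalg_gen.
by case=> [Xz|/YX//]; apply: subalg_gen.
Qed.

Lemma spans_adjoin_sub (X Y : K -> Prop) n :
    (forall z, X z -> sa Y z) -> spans (sa X) (sa (adjoin X Y)) n ->
  spans (sa X) (sa Y) n.
Proof.
move=> XY; apply: spans_sub; apply: subalg_equiv => z.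
  exact: subalg_adjoinr.
by case=> [/XY|Yz] //; apply: subalg_gen.
Qed.

Definition coords i : K -> Prop := fun y => exists2 j, (j < i)%N & y = x j.
Definition recips i : K -> Prop := fun y => exists v, [/\ v \in flag i, v != 0 & y = v^-1].
Definition orbprod_gens : K -> Prop := fun y => exists2 i, (i < r)%N & y = orbprod i.
Definition dickson_gens : K -> Prop := fun y => exists2 i, (i < r)%N & y = dickson r i.
Definition rorbsum_gens i : K -> Prop := fun y => exists2 j, (i <= j < r)%N & y = rorbsum j.
Definition rdickson_gens : K -> Prop := fun y => exists2 i, (i < r)%N & y = rdickson r i.+1.

Lemma coords_mono i j y : (i <= j)%N -> coords i y -> coords j y.
Proof. by move=> le_ij [k lt_ki ->]; exists k => //; apply: leq_trans le_ij. Qed.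

Lemma sa_coords_mono i j y : (i <= j)%N -> sa (coords i) y -> sa (coords j) y.
Proof.
by move=> le_ij; apply: subalg_trans => z /(coords_mono le_ij); apply: subalg_gen.
Qed.

Lemma dickson_orbprod_coords i :
  (forall j, sa (coords i) (dickson i j)) /\ sa (coords i.+1) (orbprod i).
Proof.
have orbprod_of i' :
    (forall j, sa (coords i') (dickson i' j)) -> sa (coords i'.+1) (orbprod i').
  move=> dickson_i; apply: subalg_sum => j _; apply: subalg_mul.
    exact: sa_coords_mono (dickson_i j).
  by apply: subalgX; apply subalg_gen; exists i'.
elim: i => [|i [dickson_i orbprod_i]].
  suff dickson_0 j : sa (coords 0) (dickson 0 j) by split=> //; apply: orbprod_of.
  by rewrite /=; case: (_ == _); [apply: subalg1 | apply: subalg0].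
suff dickson_Si j : sa (coords i.+1) (dickson i.+1 j) by split=> //; apply: orbprod_of.
have dickson_Si' j' : sa (coords i.+1) (dickson i j') by apply: sa_coords_mono (dickson_i j').
apply: subalgB; last by apply: subalg_mul => //; apply: subalgX.
by case: j => [|j]; [apply: subalg0 | apply: subalgX].
Qed.

Lemma dickson_coords i j : sa (coords i) (dickson i j).
Proof. by case: (dickson_orbprod_coords i). Qed.

Lemma orbprod_coords i : sa (coords i.+1) (orbprod i).
Proof. by case: (dickson_orbprod_coords i). Qed.

Definition poly_over (A : K -> Prop) (p : {poly K}) := forall i, A p`_i.

Section PolyOver.
Variable X : K -> Prop.
Local Notation over := (poly_over (sa X)).

Lemma poly_overC a : sa X a -> over a%:P.
Proof. by move=> Xa i; rewrite coefC; case: ifP => // _; apply: subalg0. Qed.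

Lemma poly_overXn n : over 'X^n.
Proof. by move=> i; rewrite coefXn; case: (_ == _); [apply: subalg1 | apply: subalg0]. Qed.

Lemma poly_overD p1 p2 : over p1 -> over p2 -> over (p1 + p2).
Proof. by move=> X1 X2 i; rewrite coefD; apply: subalg_add. Qed.

Lemma poly_overB p1 p2 : over p1 -> over p2 -> over (p1 - p2).
Proof. by move=> X1 X2 i; rewrite coefB; apply: subalgB. Qed.

Lemma poly_overM p1 p2 : over p1 -> over p2 -> over (p1 * p2).
Proof.
by move=> X1 X2 i; rewrite coefM; apply: subalg_sum => j _; apply: subalg_mul.
Qed.

Lemma poly_overE p n : over p -> over (p ^+ n).
Proof.
move=> Xp; elim: n => [|n IHn]; last by rewrite exprS; apply: poly_overM.
by apply: poly_overC; apply: subalg1.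
Qed.

Lemma poly_over_fpoly i : (forall j, sa X (dickson i j)) -> over (fpoly i).
Proof.
by move=> Xk; apply: coef_fpoly_pred => //; [apply: subalg0 | apply: subalg_add].
Qed.

(** Horner's scheme: multiply the remainder by 'X, add the next coefficient, and
    subtract a multiple of d, which is possible without leaving the coefficient
    ring because d is monic. *)
Lemma monic_division (d p : {poly K}) : d \is monic -> over d -> over p ->
  exists p1 p2, [/\ over p1, p = p1 * d + p2 & (size p2 < size d)%N].
Proof.
move=> d_mon Xd; elim/poly_ind: p => [|p a IHp] Xp.
  exists 0, 0; split; last by rewrite size_poly0 size_poly_gt0 monic_neq0.
    exact/poly_overC/subalg0.
  by rewrite mul0r addr0.
have Xpa : over p /\ sa X a.
  split=> [i|]; first by have := Xp i.+1; rewrite coefD coefMX coefC addr0.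
  by have := Xp 0%N; rewrite coefD coefMX coefC add0r.
case: (Xpa) => /IHp[p1 [p2 [X1 pE lt_p2]]] Xa.
have dE : size d = (size d).-1.+1 by rewrite prednK // size_poly_gt0 monic_neq0.
pose n := (size d).-1; pose s := p2 * 'X + a%:P.
have X2 : over p2.
  have -> : p2 = p - p1 * d by rewrite pE addrC addKr.
  by apply: poly_overB; [case: Xpa | apply: poly_overM].
have Xs : over s.
  by apply: poly_overD; [apply: poly_overM (poly_overXn 1) | apply: poly_overC].
exists (p1 * 'X + (s`_n)%:P), (s - (s`_n)%:P * d); split.
- by apply: poly_overD; [apply: poly_overM (poly_overXn 1) | apply: poly_overC].
- by rewrite pE /s; ring.
rewrite dE ltnS; apply/leq_sizeP => j; rewrite -/n leq_eqVlt => /predU1P[<-|lt_nj].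
  rewrite coefB coefCM; have := monicP d_mon; rewrite /lead_coef -/n => ->.
  by rewrite mulr1 subrr.
rewrite coefB coefCM [d`_j]nth_default ?mulr0 ?subr0; last by rewrite dE.
rewrite nth_default // size_MXaddC; case: ifP => // _.
by apply: leq_trans lt_nj; rewrite ltnS -ltnS -dE.
Qed.

End PolyOver.

(** S over the invariants of the unitriangular group: x_i is a root of
    the monic additive polynomial of degree q ^ i minus its value at x_i. *)
Lemma spans_sym_unitri :
  spans (sa orbprod_gens) (sa (coords r)) (\prod_(i < r) q ^ i).
Proof.
apply: spans_adjoin_sub => [_ [i lt_ir ->]|].
  exact: sa_coords_mono (orbprod_coords i).
suff H i : (i <= r)%N ->
    spans (sa orbprod_gens) (sa (adjoin orbprod_gens (coords i)))
      (\prod_(j < i) q ^ j) by exact: H.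
elim: i => [_|i IHi lt_ir].
  by rewrite big_ord0; apply: spans_adjoin0 => z [].
rewrite big_ord_recr /=; apply: spans_step (IHi (ltnW lt_ir)) _ _ _ _.
- have [sz_f mon_f] := fpoly_lead F x i.
  have lt_f : (size (orbprod i)%:P < size (fpoly i))%N.
    by rewrite sz_f (leq_ltn_trans (size_polyC_leq1 _)) // ltnS expn_gt0 card_F_gt0.
  apply: (spans_root (p := fpoly i - (orbprod i)%:P) (y := x i)).
  + by rewrite monicE lead_coefDl ?size_polyN // -monicE.
  + by rewrite size_polyDl ?size_polyN.
  + apply: poly_overB.
      apply: poly_over_fpoly => j.
      by apply: subalg_trans (dickson_coords i j) => z; apply: subalg_adjoinr.
    apply: poly_overC; apply: subalg_adjoinl; apply subalg_gen; by exists i.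
  apply/eqP; rewrite hornerD hornerN hornerC horner_fpoly; exact: subrr.
- by move=> z; apply: coords_mono.
- by move=> z <-; apply: subalg_adjoinr; exists i.
move=> z [j]; rewrite ltnS leq_eqVlt => /predU1P[->|lt_ji] ->.
  exact: subalg_adjoinr.
by apply: subalg_adjoinl; apply: subalg_adjoinr; exists j.
Qed.

(** S over the Dickson invariants: x_i is a root of the quotient of the
    polynomials of the last and the i-th step of the flag, the product of the
    factors T - v over the vectors v outside the span of the previous x_j. *)
Lemma spans_sym_gl :
  spans (sa dickson_gens) (sa (coords r)) (\prod_(i < r) (q ^ r - q ^ i)).
Proof.
apply: spans_adjoin_sub => [_ [i lt_ir ->]|]; first exact: dickson_coords.
suff H i : (i <= r)%N ->
    spans (sa dickson_gens) (sa (adjoin dickson_gens (coords i)))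
      (\prod_(j < i) (q ^ r - q ^ j))
  by exact: H.
elim: i => [_|i IHi lt_ir].
  by rewrite big_ord0; apply: spans_adjoin0 => z [].
rewrite big_ord_recr /=; apply: spans_step (IHi (ltnW lt_ir)) _ _ _ _.
- have [sz_i mon_i] := fpoly_lead F x i; have [sz_r mon_r] := fpoly_lead F x r.
  have over_i : poly_over (sa (adjoin dickson_gens (coords i))) (fpoly i).
    apply: poly_over_fpoly => j.
    by apply: subalg_trans (dickson_coords i j) => z; apply: subalg_adjoinr.
  have over_r : poly_over (sa (adjoin dickson_gens (coords i))) (fpoly r).
    apply: poly_over_fpoly => j; have [lt_jr|] := ltnP j r.
      by apply: subalg_adjoinl; apply subalg_gen; exists j.
    rewrite leq_eqVlt => /predU1P[<-|lt_rj].
      by rewrite dickson_diag; apply: subalg1.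
    by rewrite dickson_gt //; apply: subalg0.
  have [p1 [p2 [over1 rE lt_p2]]] := monic_division mon_i over_i over_r.
  (* The remainder vanishes on V_i, so it has too many roots. *)
  have p20 : p2 = 0.
    apply/eqP; apply: contraLR lt_p2 => p2_neq0; rewrite -leqNgt sz_i -(size_flag c x).
    apply: max_poly_roots p2_neq0 _ (flag_uniq x_free (ltnW lt_ir)).
    apply/allP=> v iv; have /eqP := congr1 (fun p => p.[v]) rE.
    rewrite !hornerE !horner_fpoly (addpoly_flag iv) mulr0 add0r.
    by rewrite (addpoly_flag (flag_le (ltnW lt_ir) iv)) eq_sym.
  rewrite p20 addr0 in rE.
  have p1_mon : p1 \is monic by rewrite -(monicMr _ mon_i) -rE.
  apply: (spans_root (y := x i) p1_mon _ over1 _).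
    have : size (fpoly r) = size (p1 * fpoly i) by rewrite -rE.
    rewrite size_Mmonic ?monic_neq0 //; rewrite sz_i sz_r addnS /= => E.
    rewrite -subSn; first by rewrite E addnK.
    by rewrite leq_pexp2l ?card_F_gt0 // ltnW.
  have /eqP := congr1 (fun p => p.[x i]) rE.
  rewrite hornerM !horner_fpoly (addpoly_flag (flag_le lt_ir (flag_gen c x i))).
  by rewrite eq_sym mulf_eq0 -/(orbprod i) (negPf (orbprod_neq0 x_free lt_ir)) orbF.
- by move=> z; apply: coords_mono.
- by move=> z <-; apply: subalg_adjoinr; exists i.
move=> z [j]; rewrite ltnS leq_eqVlt => /predU1P[->|lt_ji] ->.
  exact: subalg_adjoinr.
by apply: subalg_adjoinl; apply: subalg_adjoinr; exists j.
Qed.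

Lemma recips_flag_diff i v : (i < r)%N -> v \in flag i -> recips i.+1 (x i - v)^-1.
Proof.
move=> lt_ir iv; exists (x i - v); split=> //.
  by apply: flagB; [apply: flag_gen | apply: flag_mono].
by rewrite subr_eq0; apply: contraNneq (x_free lt_ir) => ->.
Qed.

Lemma rorbsum_recips i : (i < r)%N -> sa (recips i.+1) (rorbsum i).
Proof.
move=> lt_ir; rewrite (rorbsum_sum x_free lt_ir); apply: subalg_sum_mem => v iv.
by apply: subalg_gen; apply: recips_flag_diff.
Qed.

Lemma recips_mono i j y : (i <= j)%N -> recips i y -> recips j y.
Proof. by move=> le_ij [v [iv v0 ->]]; exists v; split=> //; apply: flag_le iv. Qed.

Lemma orbprods_inv_recips : sa (recips r) (orbprods F x r)^-1.
Proof.
rewrite /orbprods -prodfV; apply: subalg_prod_mem => i _.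
rewrite -[orbprod _]/(addpoly _ (x _)) (addpoly_prod x_free _ (ltnW (ltn_ord i))) -prodfV.
apply: subalg_prod_mem => v iv; apply: subalg_gen.
exact: recips_mono (ltn_ord i) (recips_flag_diff (ltn_ord i) iv).
Qed.

(** Partial fractions reduce the product of the inverses of x_i - v and x_i - w
    when v != w.  The square of the inverse of x_i - v is rorbsum i times it
    minus such products, since rorbsum i is the sum of all these inverses.  As
    rorbsum i is in the coefficient ring, it also replaces the inverse of x_i
    by 1 among the generators. *)
Lemma spans_partial_fractions (X : K -> Prop) i : (i < r)%N ->
    sa X (rorbsum i) -> (forall z, recips i z -> sa X z) ->
  spans (sa X) (sa (adjoin X (recips i.+1))) (q ^ i).
Proof.
move=> lt_ir Xff Xrec; have uniq_i := flag_uniq x_free (ltnW lt_ir).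
pose y v := (x i - v)^-1.
pose s := 1 :: [seq y v | v <- rem 0 (flag i)].
have xv_neq0 v : v \in flag i -> x i - v != 0.
  by move=> iv; rewrite subr_eq0; apply: contraNneq (x_free lt_ir) => ->.
have s1 : span (sa X) s 1 by apply: span_mem; rewrite inE eqxx.
have sy v : v \in flag i -> span (sa X) s (y v).
  have y_rem w : w \in rem 0 (flag i) -> span (sa X) s (y w).
    by move=> iw; apply: span_mem; rewrite inE; apply/orP; right; apply: map_f.
  move=> iv; have [->|v0] := eqVneq v 0; last first.
    by apply: y_rem; rewrite mem_rem_uniq // inE v0.
  have -> : y 0 = rorbsum i * 1 - \sum_(w <- rem 0 (flag i)) y w.
    by rewrite mulr1 (rorbsum_sum x_free lt_ir) (big_rem 0) ?flag0 //= addrK.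
  apply: spanB; first exact: spanZ.
  by rewrite big_seq; apply: span_sum => w /y_rem.
have inv_diff v w : v \in flag i -> w \in flag i -> v != w -> sa X (v - w)^-1.
  move=> iv iw vw; apply: Xrec; exists (v - w); split=> //; first exact: flagB.
  by rewrite subr_eq0.
have syy_neq v w : v \in flag i -> w \in flag i -> v != w ->
    span (sa X) s (y v * y w).
  move=> iv iw vw.
  have -> : y v * y w = (v - w)^-1 * (y v - y w).
    have := xv_neq0 v iv; have := xv_neq0 w iw.
    rewrite /y => w0 v0; have vw0 : v - w != 0 by rewrite subr_eq0.
    by field; rewrite v0 w0 vw0.
  apply: spanZ; first exact: inv_diff.
  by apply: spanB; apply: sy.
have syy v w : v \in flag i -> w \in flag i -> span (sa X) s (y v * y w).
  move=> iv iw; have [<-|] := eqVneq v w; last exact: syy_neq.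
  have -> : y v * y v = rorbsum i * y v - \sum_(u <- rem v (flag i)) y v * y u.
    rewrite (rorbsum_sum x_free lt_ir) (big_rem v) //= mulrDl mulr_suml.
    by under eq_bigr => u _ do rewrite mulrC; rewrite addrK.
  apply: spanB; first by apply: spanZ => //; apply: sy.
  rewrite big_seq; apply: span_sum => u; rewrite mem_rem_uniq // inE => /andP[uv iu].
  by apply: syy_neq => //; rewrite eq_sym.
exists s; split=> //.
- rewrite /= size_map size_rem ?flag0 // size_flag prednK //.
  by rewrite expn_gt0 card_F_gt0.
- by rewrite expn_gt0 card_F_gt0.
- move=> z; rewrite inE => /predU1P[->|/mapP[v iv ->]]; first exact: subalg1.
  have {}iv := mem_rem iv.
  by apply: subalg_adjoinr; apply: recips_flag_diff.
move=> z Xz; rewrite -[z]mulr1.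
apply: (subalg_stable (M := span (sa X) s) _ _ _ Xz) => //.
- exact: spanD.
- by move=> a m; apply: spanZ; apply: subalg_const.
move=> g m [Xg|[w [/flagSP[v [a [iv ->]]] w0 ->]]] sm.
  by apply: spanZ => //; apply: subalg_gen.
have [a0|a0] := eqVneq a 0.
  apply: spanZ => //; apply: Xrec; exists v; move: w0.
  by rewrite a0 rmorph0 mul0r addr0.
have ca0 : c a != 0 by rewrite fmorph_eq0.
have iu : - (c a^-1 * v) \in flag i by apply/flagN/flagZ.
have -> : (v + c a * x i)^-1 = c a^-1 * y (- (c a^-1 * v)).
  by rewrite /y fmorphV -invfM opprK mulrDr mulrA divff // mul1r addrC.
rewrite -mulrA; apply: spanZ; first exact: subalg_const.
apply: (span_sub (M := fun u => span (sa X) s (y _ * u)) _ _ _ sm).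
- by rewrite mulr0; apply: span0.
- by move=> u1 u2 M1 M2; rewrite mulrDr; apply: spanD.
move=> b u Xb; rewrite inE mulrCA => su; apply: spanZ => //.
case/predU1P: su => [->|/mapP[v' /mem_rem iv' ->]]; first by rewrite mulr1; apply: sy.
exact: syy.
Qed.

Lemma rorbsum_gens_recips z : rorbsum_gens 0 z -> sa (recips r) z.
Proof.
move=> [i /= lt_ir ->]; apply: subalg_trans (rorbsum_recips lt_ir) => y iy.
by apply: subalg_gen; apply: recips_mono iy.
Qed.

Lemma spans_recip_unitri :
  spans (sa (rorbsum_gens 0)) (sa (recips r)) (\prod_(i < r) q ^ i).
Proof.
apply: spans_adjoin_sub; first exact: rorbsum_gens_recips.
suff H i : (i <= r)%N ->
    spans (sa (rorbsum_gens 0)) (sa (adjoin (rorbsum_gens 0) (recips i)))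
      (\prod_(j < i) q ^ j)
  by exact: H.
elim: i => [_|i IHi lt_ir].
  rewrite big_ord0; apply: spans_adjoin0 => z [v []].
  by rewrite inE => /eqP->; rewrite eqxx.
rewrite big_ord_recr /=; apply: spans_step (IHi (ltnW lt_ir)) _ _ _ _.
- apply: spans_partial_fractions => // [|z iz].
    by apply: subalg_adjoinl; apply subalg_gen; exists i.
  exact: subalg_adjoinr.
- by move=> z; apply: recips_mono.
- by move=> z iz; apply: subalg_adjoinr.
by move=> z iz; apply: subalg_adjoinr.
Qed.

Lemma rdickson_rorbsum_gens i j : (i <= r)%N -> sa (rorbsum_gens 0) (rdickson i j).
Proof.
elim: i j => [|i IHi] j le_ir.
  case: j => [|j]; first by rewrite (rdickson0 x_free) //; apply: subalg1.
  by rewrite rdickson_gt //; apply: subalg0.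
case: j => [|j]; first by rewrite (rdickson0 x_free) //; apply: subalg1.
have {}IHi j' := IHi j' (ltnW le_ir).
rewrite (rdicksonSS x_free) //; apply: subalgB => //.
apply: subalg_mul; apply: subalgX => //.
by apply subalg_gen; exists i.
Qed.

(** rdickson i j as a polynomial in rorbsum i over the ring generated by the
    rdickson (i + 1) k. *)
Fixpoint hpoly i j : {poly K} :=
  if j is j'.+1 then (rdickson i.+1 j)%:P + 'X^(q.-1) * hpoly i j' ^+ q else 1.

Lemma horner_hpoly i j : (i < r)%N -> (hpoly i j).[rorbsum i] = rdickson i j.
Proof.
move=> lt_ir; elim: j => [|j IHj]; first by rewrite hornerC (rdickson0 x_free) // ltnW.
rewrite /= hornerD hornerC hornerM hornerXn horner_exp IHj (rdicksonSS x_free) //.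
by rewrite subrK.
Qed.

Lemma hpoly_lead i j : size (hpoly i j) = (q ^ j)%N /\ hpoly i j \is monic.
Proof.
elim: j => [|j [sz_j mon_j]]; first by rewrite size_poly1 monic1.
have mon_qj : hpoly i j ^+ q \is monic by apply: monic_exp.
have sz_M : size ('X^(q.-1) * hpoly i j ^+ q) = (q ^ j.+1)%N.
  have sz_q : size (hpoly i j ^+ q) = ((q ^ j).-1 * q).+1.
    by rewrite -sz_j -size_exp prednK // size_poly_gt0 monic_neq0.
  rewrite size_monicM ?monicXn ?monic_neq0 // size_polyXn sz_q addSn addnS /=.
  rewrite -addSn prednK ?card_F_gt0 // -mulSn prednK ?expn_gt0 ?card_F_gt0 //.
  by rewrite expnSr.
have lt_C : (size (rdickson i.+1 j.+1)%:P < size ('X^(q.-1) * hpoly i j ^+ q)%R)%N.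
  rewrite sz_M (leq_ltn_trans (size_polyC_leq1 _)) //.
  by rewrite -(expn0 q) ltn_exp2l ?finNzRing_gt1.
rewrite /= addrC; split; first by rewrite size_polyDl.
by rewrite monicE lead_coefDl // -monicE monicMl ?monicXn.
Qed.

Lemma poly_over_hpoly (X : K -> Prop) i j :
  (forall k, sa X (rdickson i.+1 k)) -> poly_over (sa X) (hpoly i j).
Proof.
move=> Xh; elim: j => [|j IHj] /=; first by apply: poly_overC; apply: subalg1.
apply: poly_overD; first exact: poly_overC.
by apply: poly_overM; [apply: poly_overXn | apply: poly_overE].
Qed.

(** Going down the flag, each rdickson i j is a monic polynomial of degree
    q ^ j - 1 in rorbsum i over the previous ring, and it vanishes for
    j = i + 1. *)
Lemma spans_recip_gl_unitri :
  spans (sa rdickson_gens) (sa (rorbsum_gens 0)) (\prod_(i < r) (q ^ i.+1 - 1)).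
Proof.
apply: spans_adjoin_sub => [z [i lt_ir ->]|]; first exact: rdickson_rorbsum_gens.
suff H k : (k <= r)%N ->
    (forall j, sa (adjoin rdickson_gens (rorbsum_gens (r - k))) (rdickson (r - k) j)) /\
    spans (sa rdickson_gens) (sa (adjoin rdickson_gens (rorbsum_gens (r - k))))
      (\prod_(i < r | (r - k <= i)%N) (q ^ i.+1 - 1)).
  have [_] := H _ (leqnn r); rewrite subnn.
  by rewrite (eq_bigl predT).
elim: k => [_|k IHk lt_kr].
  rewrite subn0; split=> [j|].
    have [->|] := posnP j; first by rewrite (rdickson0 x_free) //; apply: subalg1.
    case: j => // j _; have [lt_jr|le_rj] := ltnP j r.
      by apply: subalg_adjoinl; apply subalg_gen; exists j.
    by rewrite rdickson_gt //; apply: subalg0.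
  rewrite big1 => [|i]; last by rewrite leqNgt ltn_ord.
  by apply: spans_adjoin0 => z [j]; rewrite leqNgt andNb.
have [rdickson_k spans_k] := IHk (ltnW lt_kr); set i := (r - k.+1)%N.
have iE : (r - k)%N = i.+1 by rewrite /i subnSK.
have lt_ir : (i < r)%N by rewrite /i -iE leq_subr.
rewrite iE in rdickson_k spans_k.
have over_h j := poly_over_hpoly j rdickson_k.
have spans_i : spans (sa (adjoin rdickson_gens (rorbsum_gens i.+1)))
    (sa (adjoin (adjoin rdickson_gens (rorbsum_gens i.+1)) (eq (rorbsum i)))) (q ^ i.+1 - 1).
  have [sz_h mon_h] := hpoly_lead i i.+1.
  apply: (spans_root (p := hpoly i i.+1) (y := rorbsum i)) => //.
    by rewrite sz_h subn1 prednK // expn_gt0 card_F_gt0.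
    exact: over_h.
  by rewrite /root horner_hpoly // rdickson_gt.
have gens_i z : rorbsum_gens i z -> rorbsum_gens i.+1 z \/ z = rorbsum i.
  case=> j /andP[]; rewrite leq_eqVlt => /predU1P[<-|lt_ij] lt_jr ->; first by right.
  by left; exists j => //; apply/andP.
have gens_Si z : rorbsum_gens i.+1 z -> rorbsum_gens i z.
  by case=> j /andP[lt_ij lt_jr] ->; exists j => //; rewrite ltnW.
split=> [j|].
  elim: j => [|j IHj]; first by rewrite (rdickson0 x_free) ?(ltnW lt_ir) //; apply: subalg1.
  have -> : rdickson i j.+1 = rdickson i.+1 j.+1 + rorbsum i ^+ q.-1 * rdickson i j ^+ q.
    by rewrite (rdicksonSS x_free) // subrK.
  apply: subalg_add.
    apply: subalg_trans (rdickson_k j.+1) => z [hz|/gens_Si fz].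
      by apply: subalg_adjoinl; apply: subalg_gen.
    exact: subalg_adjoinr.
  apply: subalg_mul; apply: subalgX => //; apply: subalg_adjoinr.
  by exists i; rewrite ?leqnn.
rewrite (bigD1 (Ordinal lt_ir)) //= mulnC.
rewrite (eq_bigl (fun j : 'I_r => (i.+1 <= j)%N)) => [|j]; last first.
  by rewrite ltn_neqAle -val_eqE /= eq_sym andbC.
apply: spans_step spans_k spans_i _ _ _ => // z.
- by move=> <-; apply: subalg_adjoinr; exists i; rewrite ?leqnn.
by case/gens_i=> [fz|->]; [apply: subalg_adjoinl|]; apply: subalg_adjoinr.
Qed.

Lemma spans_recip_gl :
  spans (sa rdickson_gens) (sa (recips r))
    ((\prod_(i < r) (q ^ i.+1 - 1)) * \prod_(i < r) q ^ i).
Proof.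
apply: spans_trans spans_recip_gl_unitri spans_recip_unitri.
by apply: subalg_trans; apply: rorbsum_gens_recips.
Qed.

End Towers.

(** * Invariance of the coefficients *)

Section FlagAction.
Variables (F : finFieldType) (K : fieldType) (c : {rmorphism F -> K}).
Variables (r : nat) (x : nat -> K).
Hypothesis x_free : forall i, (i < r)%N -> x i \notin flag c x i.
Variable sigma : {rmorphism K -> K}.

Local Notation q := #|F|.
Local Notation flag := (flag c x).
Local Notation dickson := (dickson F x).
Local Notation orbprod := (orbprod F x).
Local Notation fpoly := (fpoly F x).

Lemma coef_fpoly i j : (j <= i)%N -> (fpoly i)`_(q ^ j) = dickson i j.
Proof.
rewrite -ltnS => lt_ji; rewrite coef_sum (bigD1 (Ordinal lt_ji)) //=.
rewrite coefZ coefXn eqxx mulr1 big1 ?addr0 // => k k_j.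
rewrite coefZ coefXn eqn_exp2l ?finNzRing_gt1 //.
by move: k_j; rewrite -val_eqE /= eq_sym => /negPf->; rewrite mulr0.
Qed.

(** The roots of the last additive polynomial are permuted. *)
Lemma dickson_stable j : (forall v, v \in flag r -> sigma v \in flag r) ->
  sigma (dickson r j) = dickson r j.
Proof.
move=> stab; have [lt_rj|le_jr] := ltnP r j; first by rewrite dickson_gt // rmorph0.
rewrite -(coef_fpoly le_jr) -coef_map.
have uniq_r := flag_uniq x_free (leqnn r).
rewrite (fpoly_prod x_free) // rmorph_prod /=.
suff -> : \prod_(v <- flag r) map_poly sigma ('X - v%:P) =
    \prod_(v <- flag r) ('X - v%:P) by [].
rewrite [RHS](perm_big [seq sigma v | v <- flag r]) /=.
  rewrite big_map; apply: eq_bigr => v _.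
  by rewrite rmorphB /= map_polyX map_polyC.
have sub : {subset [seq sigma v | v <- flag r] <= flag r}.
  by move=> w /mapP[v rv ->]; apply: stab.
have uniq_s : uniq [seq sigma v | v <- flag r].
  by rewrite map_inj_uniq //; apply: fmorph_inj.
have [_ eq_mem] := uniq_min_size uniq_s sub (eq_leq (esym (size_map _ _))).
by apply: uniq_perm => // w; rewrite eq_mem.
Qed.

(** An automorphism that moves each x_i by a combination of the previous ones
    fixes the values of the additive polynomials, as these vanish on the
    differences. *)
Lemma dickson_orbprod_unitri i : (i <= r)%N ->
    (forall j, (j < r)%N -> sigma (x j) - x j \in flag j) ->
  (forall j, sigma (dickson i j) = dickson i j) /\
  ((i < r)%N -> sigma (orbprod i) = orbprod i).
Proof.
move=> + uni.
have orbprod_of k : (forall j, sigma (dickson k j) = dickson k j) -> (k < r)%N ->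
    sigma (orbprod k) = orbprod k.
  move=> dickson_k lt_kr; transitivity (addpoly F x k (sigma (x k))).
    rewrite rmorph_sum; apply: eq_bigr => j _.
    by rewrite rmorphM rmorphXn /= dickson_k.
  rewrite -[sigma (x k)](subrK (x k)) (addpolyD c) (addpoly_flag (uni k lt_kr)).
  by rewrite add0r.
elim: i => [_|i IHi lt_ir].
  suff dickson_0 j : sigma (dickson 0 j) = dickson 0 j by split=> //; apply: orbprod_of.
  by rewrite /= rmorph_nat.
have [dickson_i /(_ lt_ir) orbprod_i] := IHi (ltnW lt_ir).
suff dickson_Si j : sigma (dickson i.+1 j) = dickson i.+1 j by split=> //; apply: orbprod_of.
case: j => [|j]; first by rewrite dicksonS0 rmorphN rmorphM rmorphXn /= orbprod_i dickson_i.
by rewrite dicksonSS rmorphB rmorphM !rmorphXn /= orbprod_i !dickson_i.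
Qed.

Lemma orbprod_unitri i : (i < r)%N ->
    (forall j, (j < r)%N -> sigma (x j) - x j \in flag j) -> sigma (orbprod i) = orbprod i.
Proof. by move=> lt_ir uni; have [_ ->] := dickson_orbprod_unitri (ltnW lt_ir) uni. Qed.

Lemma rorbsum_unitri i : (i < r)%N ->
    (forall j, (j < r)%N -> sigma (x j) - x j \in flag j) ->
  sigma (rorbsum F x i) = rorbsum F x i.
Proof.
move=> lt_ir uni; have [dickson_i orbprod_i] := dickson_orbprod_unitri (ltnW lt_ir) uni.
by rewrite /rorbsum fmorph_div dickson_i orbprod_i.
Qed.

Lemma rdickson_stable j : (forall v, v \in flag r -> sigma v \in flag r) ->
  sigma (rdickson F x r j) = rdickson F x r j.
Proof. by move=> stab; rewrite /rdickson fmorph_div !dickson_stable. Qed.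

(** The Moore matrix (x_i ^ (q ^ j)) becomes triangular, with the orbprod i on the
    diagonal, when its columns are combined with the coefficients of the
    additive polynomials. *)
Lemma moore_det : \det (\matrix_(i < r, j < r) x i ^+ (q ^ j)) = orbprods F x r.
Proof.
pose T := \matrix_(j < r, l < r) dickson l j.
have detT : \det T = 1.
  rewrite -det_tr det_trig.
    by rewrite big1 // => i _; rewrite !mxE dickson_diag.
  by apply/is_trig_mxP => i j lt_ij; rewrite !mxE dickson_gt.
rewrite -[LHS]mulr1 -detT -det_mulmx; set W := _ *m T.
have WE i l : W i l = addpoly F x l (x i).
  rewrite mxE /addpoly (big_ord_widen r (fun j => dickson l j * x i ^+ (q ^ j))) //.
  rewrite [LHS](bigID (fun j : 'I_r => (j < l.+1)%N)) /= [X in _ + X]big1 ?addr0.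
    by apply: eq_bigr => j _; rewrite !mxE mulrC.
  by move=> j; rewrite -leqNgt => lt_lj; rewrite !mxE dickson_gt // mulr0.
rewrite det_trig; first by apply: eq_bigr => i _; rewrite WE.
apply/is_trig_mxP => i l lt_il; rewrite WE (addpoly_flag (c := c)) //.
exact: flag_le lt_il (flag_gen c x i).
Qed.

(** The morphism acts on the Moore matrix by left multiplication by M, as the
    scalars are fixed by q-th powers. *)
Lemma orbprods_semi_invariant (M : 'M[F]_r) :
    (forall i : 'I_r, sigma (x i) = \sum_(j < r) c (M i j) * x j) ->
  sigma (orbprods F x r) = c (\det M) * orbprods F x r.
Proof.
move=> sigma_x; rewrite -moore_det -det_map_mx -[in RHS]det_map_mx -det_mulmx.
congr (\det _); apply/matrixP=> i k; rewrite !mxE rmorphXn /= sigma_x.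
have sumX (s : seq 'I_r) (f : 'I_r -> K) n :
    (\sum_(j <- s) f j) ^+ (q ^ n) = \sum_(j <- s) f j ^+ (q ^ n).
  apply: (big_morph (fun y => y ^+ (q ^ n))) => [y z|].
    exact: (frobenius_iterD c).
  by rewrite expr0n expn_eq0 eqn0Ngt card_F_gt0.
rewrite sumX; apply: eq_bigr => j _.
by rewrite !mxE exprMn frobenius_scalar.
Qed.

End FlagAction.

(** * The action on the field of fractions *)

Section FractionAction.
Variables (F : finFieldType) (V : vectType F).
Local Notation K := (SymFrac F V).
Local Notation c := (symfracC V).

Lemma symfracC_zmod : zmod_morphism c.
Proof. by move=> a b; rewrite /symfracC mpolyCB tofracB. Qed.

Lemma symfracC_monoid : monoid_morphism c.
Proof. by split=> [|a b]; rewrite /symfracC ?tofrac1 // mpolyCM tofracM. Qed.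

HB.instance Definition _ := GRing.isZmodMorphism.Build F K c symfracC_zmod.
HB.instance Definition _ := GRing.isMonoidMorphism.Build F K c symfracC_monoid.

Lemma fraction_exists (y : K) : exists a b, b != 0 /\ y = a%:F / b%:F.
Proof.
pose z := generic_quotient.repr y; exists (\n_z), (\d_z).
by split; [apply: denom_ratioP | apply: fracE].
Qed.

Lemma symfrac_act_tofrac (g : gl V) p : symfrac_act g p%:F = (sym_act g p)%:F.
Proof.
by have := symfrac_actE g p (oner_neq0 _); rewrite !rmorph1 !divr1.
Qed.

Lemma sym_act_neq0 (g : gl V) p : p != 0 -> sym_act g p != 0.
Proof. by apply: contra_neq => gp0; apply: (@sym_act_inj _ _ g); rewrite gp0 rmorph0. Qed.

Lemma symfrac_act_zmod (g : gl V) : zmod_morphism (symfrac_act g : K -> K).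
Proof.
move=> y z; have [a [b [b0 ->]]] := fraction_exists y.
have [a' [b' [b0' ->]]] := fraction_exists z.
have [gb0 gb0'] := (sym_act_neq0 g b0, sym_act_neq0 g b0').
rewrite -mulNr -tofracN addf_div ?tofrac_eq0 // -!tofracM -tofracD.
rewrite !symfrac_actE ?mulf_neq0 // -mulNr -tofracN addf_div ?tofrac_eq0 //.
by rewrite -!tofracM -tofracD rmorphD !rmorphM rmorphN.
Qed.

Lemma symfrac_act_monoid (g : gl V) : monoid_morphism (symfrac_act g : K -> K).
Proof.
split=> [|y z]; first by rewrite -tofrac1 symfrac_act_tofrac rmorph1.
have [a [b [b0 ->]]] := fraction_exists y.
have [a' [b' [b0' ->]]] := fraction_exists z.
by rewrite mulf_div -!tofracM !symfrac_actE ?mulf_neq0 // mulf_div -!tofracM !rmorphM.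
Qed.

HB.instance Definition _ (g : gl V) :=
  GRing.isZmodMorphism.Build K K (symfrac_act g) (symfrac_act_zmod g).
HB.instance Definition _ (g : gl V) :=
  GRing.isMonoidMorphism.Build K K (symfrac_act g) (symfrac_act_monoid g).

Lemma symfrac_actM (g h : gl V) y :
  symfrac_act (g * h)%g y = symfrac_act g (symfrac_act h y).
Proof.
have [a [b [b0 ->]]] := fraction_exists y.
by rewrite !symfrac_actE ?sym_act_neq0 // !sym_actM.
Qed.

Lemma symfrac_act_c (g : gl V) a : symfrac_act g (c a) = c a.
Proof.
rewrite /symfracC symfrac_act_tofrac -[a%:MP]mulr1 mul_mpolyC linearZ /=.
by rewrite rmorph1.
Qed.

Definition vecfrac (v : V) : K := (symv v)%:F.

Lemma symfrac_act_vec (g : gl V) v : symfrac_act g (vecfrac v) = vecfrac (g v).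
Proof. by rewrite /vecfrac symfrac_act_tofrac sym_act_symv. Qed.

Lemma vecfracD v w : vecfrac (v + w) = vecfrac v + vecfrac w.
Proof. by rewrite /vecfrac linearD tofracD. Qed.

Lemma vecfracZ a v : vecfrac (a *: v) = c a * vecfrac v.
Proof. by rewrite /vecfrac linearZ /= -mul_mpolyC tofracM. Qed.

Lemma vecfrac0 : vecfrac 0 = 0.
Proof. by rewrite /vecfrac linear0 tofrac0. Qed.

Lemma vecfracB v w : vecfrac (v - w) = vecfrac v - vecfrac w.
Proof. by rewrite /vecfrac linearB tofracB. Qed.

Lemma vecfrac_sum (I : Type) (s : seq I) (f : I -> V) :
  vecfrac (\sum_(i <- s) f i) = \sum_(i <- s) vecfrac (f i).
Proof. exact: (big_morph _ vecfracD vecfrac0). Qed.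

Lemma vecfrac_eq0 v : (vecfrac v == 0) = (v == 0).
Proof. by rewrite /vecfrac tofrac_eq0 symv_eq0. Qed.

Lemma vecfrac_inj : injective vecfrac.
Proof. by move=> v w /eqP; rewrite -subr_eq0 -vecfracB vecfrac_eq0 subr_eq0 => /eqP. Qed.

Variables (b : (\dim {:V}).-tuple V).
Hypothesis b_basis : basis_of {:V} b.
Local Notation r := (\dim {:V}).

Definition bvec i : K := vecfrac b`_i.

Lemma span_takeS i : (i < r)%N -> (<<take i.+1 b>> = <<take i b>> + <[b`_i]>)%VS.
Proof.
move=> lt_ir; rewrite (take_nth 0) ?size_tuple // -cats1 span_cat.
by rewrite span_seq1.
Qed.

Lemma flag_vecP i y : (i <= r)%N ->
  reflect (exists2 v, v \in <<take i b>>%VS & y = vecfrac v) (y \in flag c bvec i).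
Proof.
elim: i y => [|i IHi] y le_ir.
  rewrite take0 span_nil inE; apply: (iffP eqP) => [->|[v]].
    by exists 0; rewrite ?mem0v ?vecfrac0.
  by rewrite memv0 => /eqP-> ->; rewrite vecfrac0.
have {}IHi z := IHi z (ltnW le_ir); rewrite span_takeS //.
apply: (iffP (flagSP c bvec i y)) => [[_ [a [/IHi[v iv ->] ->]]]|[v]].
  exists (v + a *: b`_i); last by rewrite vecfracD vecfracZ.
  by apply: memv_add => //; apply: memvZ; apply: memv_line.
case/memv_addP=> w iw [w' /vlineP[a ->] ->] ->.
exists (vecfrac w), a; split; last by rewrite vecfracD vecfracZ.
by apply/IHi; exists w.
Qed.

Lemma bvec_free i : (i < r)%N -> bvec i \notin flag c bvec i.
Proof.
move=> lt_ir; apply/negP => /(flag_vecP _ (ltnW lt_ir))[v iv /vecfrac_inj bv].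
have free_b := basis_free b_basis.
have : free (b`_i :: take i b).
  have free_S : free (take i.+1 b).
    by move: free_b; rewrite -{1}(cat_take_drop i.+1 b) => /catl_free.
  rewrite (@perm_free _ _ _ (take i.+1 b)) // (take_nth 0) ?size_tuple //.
  by rewrite perm_sym perm_rcons.
by rewrite free_cons bv iv.
Qed.

Lemma flag_full y : reflect (exists v, y = vecfrac v) (y \in flag c bvec r).
Proof.
apply: (iffP (flag_vecP y (leqnn r))) => [[v _ ->]|[v ->]]; exists v => //.
by rewrite take_oversize ?size_tuple // (span_basis b_basis) memvf.
Qed.

Lemma recip_algE y : recip_alg y <-> subalg c (recips c bvec r) y.
Proof.
rewrite /recip_alg; apply: (@subalg_equiv F K c) => z.
  move=> [v v0 ->]; apply subalg_gen; exists (vecfrac v).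
  by rewrite vecfrac_eq0; split=> //; apply/flag_full; exists v.
move=> [_ [/flag_full[v ->] v0 ->]]; apply subalg_gen; exists v => //.
by rewrite -vecfrac_eq0.
Qed.

Lemma sym_algE y : (exists p : SymAlg F V, y = p%:F) <-> subalg c (coords bvec r) y.
Proof.
split=> [[p ->]|]; last first.
  elim=> [a|_ [i _ ->]|_ _ _ [p ->] _ [p' ->]|_ _ _ [p ->] _ [p' ->]].
  - by exists a%:MP.
  - by exists (symv b`_i).
  - by exists (p + p'); rewrite tofracD.
  - by exists (p * p'); rewrite tofracM.
have vec_coords v : subalg c (coords bvec r) (vecfrac v).
  have vb : v \in <<b>>%VS by rewrite (span_basis b_basis) memvf.
  rewrite (coord_span vb) vecfrac_sum; apply: subalg_sum => i _.
  rewrite vecfracZ; apply: subalg_mul; first exact: subalg_const.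
  by apply subalg_gen; exists i.
rewrite [p]mpolyE rmorph_sum; apply: subalg_sum => m _.
rewrite -mul_mpolyC rmorphM; apply: subalg_mul; first exact: (subalg_const c).
rewrite mpolyXE_id rmorph_prod; apply: subalg_prod_mem => i _.
by rewrite rmorphXn /= -symv_basis; apply/subalgX/vec_coords.
Qed.

Lemma flag_act (g : gl V) v :
  v \in flag c bvec r -> symfrac_act g v \in flag c bvec r.
Proof. by move=> /flag_full[w ->]; apply/flag_full; exists (g w); rewrite symfrac_act_vec. Qed.

End FractionAction.

(** * The groups *)

Section Groups.
Variables (F : finFieldType) (V : vectType F).
Local Notation r := (\dim {:V}).
Local Notation q := #|F|.
Local Notation mx b g := (passmx.mxof b b (gl_val g)).

Lemma card_unitmx n : (0 < n)%N ->
  #|[set M : 'M[F]_n | M \in unitmx]| = #|'GL_n[F]%g|.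
Proof.
case: n => // n _; rewrite cardsT /= card_sub.
by apply: eq_card => M; rewrite !inE.
Qed.

Lemma gl_basis_ext (b : r.-tuple V) (g h : gl V) : basis_of {:V} b ->
  (forall i : 'I_r, g b`_i = h b`_i) -> g = h.
Proof.
move=> b_basis gh; apply: val_inj; apply/lfunP => v /=.
have vb : v \in <<b>>%VS by rewrite (span_basis b_basis) memvf.
rewrite (coord_span vb) !linear_sum; apply: eq_bigr => i _.
by rewrite !linearZ /= gh.
Qed.

Section Basis.
Variable b : r.-tuple V.
Hypothesis b_basis : basis_of {:V} b.

Lemma gl_mxE (g : gl V) (i : 'I_r) : g b`_i = \sum_(j < r) mx b g i j *: b`_j.
Proof.
rewrite -passmx.vecof_delta (passmx.hom_vecof b b_basis) -rowE /passmx.vecof.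
by apply: eq_bigr => j _; rewrite mxE.
Qed.

Lemma gl_mxM (g h : gl V) : mx b (g * h)%g = mx b h *m mx b g.
Proof. exact: passmx.mxof_comp. Qed.

Lemma gl_mx1 : mx b (1%g : gl V) = 1%:M.
Proof. exact: passmx.mxof1 (basis_free b_basis). Qed.

Lemma gl_mx_unit (g : gl V) : mx b g \in unitmx.
Proof.
have : mx b g^-1%g *m mx b g = 1%:M by rewrite -gl_mxM mulgV gl_mx1.
by case/mulmx1_unit.
Qed.

Lemma gl_mx_inj : injective (fun g : gl V => mx b g).
Proof.
move=> g h /(congr1 (passmx.hommx b b)).
by rewrite !passmx.mxofK // => gh; apply: val_inj.
Qed.

Lemma gl_of_mx (M : 'M[F]_r) : M \in unitmx -> exists g : gl V, mx b g = M.
Proof.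
move=> unitM; have ker0 : lker (passmx.hommx b b M) == 0%VS.
  apply/lker0P; apply: (can_inj (g := passmx.hommx b b (invmx M))) => v.
  rewrite -comp_lfunE -passmx.hommx_mul // mulmxV // passmx.hommx1 //.
  by rewrite id_lfunE.
by exists (Gl ker0); rewrite /= passmx.hommxK.
Qed.

Lemma card_gl : (0 < r)%N ->
  #|{: gl V}| = ((\prod_(i < r) (q ^ i.+1 - 1)) * \prod_(i < r) q ^ i)%N.
Proof.
move=> r_gt0; have -> : #|{: gl V}| = #|[set M : 'M[F]_r | M \in unitmx]|.
  rewrite -cardsT -(card_imset _ gl_mx_inj); apply: eq_card => M; rewrite inE.
  apply/imsetP/idP => [[g _ ->]|/gl_of_mx[g gM]]; first exact: gl_mx_unit.
  by exists g.
rewrite card_unitmx // card_GL // mulnC big_add1 big_mkord -bin2_sum expn_sum big_mkord.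
by [].
Qed.

Definition unitri : {set gl V} :=
  [set g : gl V | [forall i : 'I_r, g b`_i - b`_i \in <<take i b>>%VS]].

Lemma unitriP (g : gl V) :
  reflect (forall i, (i < r)%N -> g b`_i - b`_i \in <<take i b>>%VS) (g \in unitri).
Proof.
rewrite inE; apply: (iffP forallP) => [ug i lt_ir|ug i]; last exact: ug.
exact: (ug (Ordinal lt_ir)).
Qed.

Lemma span_take_le i j v : (i <= j)%N ->
  v \in <<take i b>>%VS -> v \in <<take j b>>%VS.
Proof.
move=> le_ij; apply: subvP; apply: sub_span => w /=.
by rewrite -(subnKC le_ij) takeD mem_cat => ->.
Qed.

Lemma unitri_diff (g : gl V) i v : g \in unitri -> (i < r)%N ->
  v \in <<take i.+1 b>>%VS -> g v - v \in <<take i b>>%VS.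
Proof.
move=> ug; elim: i v => [|i IHi] v lt_ir; rewrite span_takeS //;
  case/memv_addP=> w iw [w' /vlineP[a ->] ->] {v}; rewrite linearD linearZ /=.
  move: iw; rewrite take0 span_nil memv0 => /eqP->; rewrite linear0 !add0r.
  rewrite -scalerBr; have := unitriP _ ug 0%N lt_ir.
  by rewrite take0 span_nil => /(memvZ a).
rewrite opprD addrACA -scalerBr; apply: rpredD; last first.
  by apply/memvZ/(unitriP _ ug).
by apply: (span_take_le (leqnSn i)); apply: IHi => //; apply: ltnW.
Qed.

Lemma unitri_stable (g : gl V) i v : g \in unitri -> (i <= r)%N ->
  v \in <<take i b>>%VS -> g v \in <<take i b>>%VS.
Proof.
move=> ug le_ir iv; rewrite -(subrK v (g v)); apply: rpredD => //.
case: i le_ir iv => [|i] lt_ir iv; last first.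
  by apply: (span_take_le (leqnSn i)); apply: unitri_diff.
by move: iv; rewrite take0 span_nil memv0 => /eqP->; rewrite linear0 subr0 mem0v.
Qed.

Lemma unitri_group_set : group_set unitri.
Proof.
apply/group_setP; split=> [|g h /[dup] ug /unitriP gP /unitriP hP].
  by apply/unitriP => i _; rewrite /= id_lfunE subrr mem0v.
apply/unitriP => i lt_ir; rewrite /= comp_lfunE.
rewrite -[g (h _)](subrK (g b`_i)) -addrA; apply: rpredD; last exact: gP.
by rewrite -linearB; apply: unitri_stable (ltnW lt_ir) (hP i lt_ir).
Qed.

Canonical unitri_group := Group unitri_group_set.

Lemma unitri_unipotent : unipotent_subgroup unitri_group.
Proof.
move=> g ug; exists r => v.
suff N0 n w : (n <= r)%N -> w \in <<take n b>>%VS ->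
    iter n (fun z => g z - z) w = 0.
  by apply: N0; rewrite ?take_oversize ?size_tuple // (span_basis b_basis) memvf.
elim: n w => [|n IHn] w le_nr nw.
  by move: nw; rewrite take0 span_nil memv0 => /eqP.
by rewrite iterSr; apply: (IHn _ (ltnW le_nr)); apply: unitri_diff.
Qed.

(** Each choice of the entries below the diagonal gives such an automorphism. *)
Lemma card_unitri : (\prod_(i < r) q ^ i <= #|unitri|)%N.
Proof.
pose T := {dffun forall i : 'I_r, {ffun 'I_i -> F}}.
have cardT : #|T| = (\prod_(i < r) q ^ i)%N.
  rewrite card_dep_ffun foldrE big_image /=; apply: eq_bigr => i _.
  by rewrite card_ffun card_ord.
pose M (t : T) := \matrix_(i < r, j < r)
  (if insub (j : nat) is Some k then t i k else (i == j)%:R : F).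
have Mdiag t (i j : 'I_r) : (i <= j)%N -> M t i j = (i == j)%:R.
  by move=> le_ij; rewrite mxE insubN // -leqNgt.
have detM t : \det (M t) = 1.
  rewrite det_trig; first by rewrite big1 // => i _; rewrite Mdiag // eqxx.
  apply/is_trig_mxP => i j lt_ij; rewrite Mdiag 1?ltnW //.
  by rewrite -val_eqE /= ltn_eqF.
have /fin_all_exists[G GE] (t : T) : exists g : gl V, mx b g = M t.
  by apply: gl_of_mx; rewrite unitmxE detM unitr1.
have injG : injective G.
  move=> t u /(congr1 (fun g : gl V => mx b g)); rewrite !GE => Mtu.
  apply/ffunP=> i; apply/ffunP => k.
  have lt_kr : (k < r)%N by apply: ltn_trans (ltn_ord k) (ltn_ord i).
  have := congr1 (fun A : 'M_r => A i (Ordinal lt_kr)) Mtu; rewrite !mxE /=.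
  by rewrite valK.
rewrite -cardT -cardsT -(card_imset _ injG); apply: subset_leq_card.
apply/subsetP => _ /imsetP[t _ ->]; apply/unitriP => i lt_ir.
pose i' := Ordinal lt_ir.
rewrite (gl_mxE _ i') GE (bigD1 i') //= Mdiag // eqxx scale1r addrC addrK.
apply: rpred_sum => j j_i; have [lt_ji|le_ij] := ltnP j i; last first.
  by rewrite Mdiag // eq_sym (negPf j_i) scale0r mem0v.
apply: memvZ; apply: memv_span.
by rewrite -(nth_take 0 lt_ji) mem_nth // size_take size_tuple lt_ir.
Qed.

End Basis.
End Groups.

Section MaximalUnipotent.
Variables (F : finFieldType) (V : vectType F).
Local Notation r := (\dim {:V}).
Local Notation q := #|F|.

Lemma gl_invK (g : gl V) v : g (g^-1%g v) = v.
Proof. by have := congr1 (fun h : gl V => h v) (mulgV g); rewrite /= comp_lfunE id_lfunE. Qed.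

(** An element u of prime order l in a unipotent group: where the square of
    u - 1 vanishes, u ^ l = 1 + l (u - 1), so that u - 1 vanishes there unless
    l = 0 in F.  If l were invertible in F, nilpotency of u - 1 would give
    u = 1. *)
Lemma unipotent_pgroup p (H : {group gl V}) :
  p \in [pchar F] -> unipotent_subgroup H -> (p.-group H)%g.
Proof.
move=> charFp uniH; apply/pgroupP => l l_pr /(Cauchy l_pr)[u Hu u_l].
apply: contraT => l_p; pose N w := u w - w.
have l_neq0 : l%:R != 0 :> F.
  rewrite -(dvdn_pcharf charFp) dvdn_prime2 ?(pcharf_prime charFp) //.
    by apply: contraNneq l_p => ->; rewrite inE.
have uN w : u w = w + N w by rewrite /N addrC subrK.
have ND w w' : N (w + w') = N w + N w' by rewrite /N linearD opprD addrACA.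
have N0 : N 0 = 0 by rewrite /N linear0 subr0.
have sqN w : N (N w) = 0 -> N w = 0.
  move=> NN0; have powu k : (u ^+ k)%g w = w + k%:R *: N w.
    elim: k => [|k IHk]; first by rewrite expg0 /= id_lfunE scale0r addr0.
    rewrite expgS /= comp_lfunE IHk linearD linearZ /= (uN w) (uN (N w)) NN0 addr0.
    by rewrite -addn1 natrD addrC scalerDl scale1r addrCA addrA addrC addrA.
  have := powu l; rewrite -u_l expg_order /= id_lfunE u_l.
  move/eqP; rewrite addrC -subr_eq subrr eq_sym scaler_eq0 (negPf l_neq0).
  by move/eqP.
have nilN n w : iter n N w = 0 -> N w = 0.
  elim: n => [|[|n] IHn] //=; first by move=> ->.
  by move=> /sqN/IHn.
have u1 : u = 1%g.
  apply: val_inj; apply/lfunP => w; rewrite /= id_lfunE uN.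
  by have [n /(_ w)/nilN ->] := uniH u Hu; rewrite addr0.
by move: l_pr; rewrite -u_l u1 order1.
Qed.

Lemma pchar_card p : p \in [pchar F] -> p.-nat q.
Proof.
move=> charFp; have /abelem_pgroup := fin_ring_pchar_abelem charFp.
by rewrite /pgroup cardsT.
Qed.

(** The order of the general linear group is m * n with m prime to p and n the
    product of the q ^ i.  The order of the unitriangular group is a power of p,
    hence divides n, and it is at least n. *)
Lemma unitri_sylow p (b : r.-tuple V) : (0 < r)%N -> basis_of {:V} b ->
  p \in [pchar F] -> (p.-Sylow([set: gl V]) (unitri b))%g.
Proof.
move=> r_gt0 b_basis charFp; have p_pr := pcharf_prime charFp.
have p_q := pchar_card charFp.
have pW : (p.-group (unitri b))%g := unipotent_pgroup charFp (unitri_unipotent b_basis).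
set m := (\prod_(i < r) (q ^ i.+1 - 1))%N; set n := (\prod_(i < r) q ^ i)%N.
have cardG : #|[set: gl V]| = (m * n)%N by rewrite cardsT (card_gl b_basis).
have p'm : p^'.-nat m.
  apply: (big_ind (fun k => p^'.-nat k)) => [||i _] //.
    by move=> k k' pk pk'; rewrite pnatM pk.
  have q_gt1 : (1 < q ^ i.+1)%N.
    by rewrite -(expn0 q) ltn_exp2l // finNzRing_gt1.
  rewrite p'natE ?subn_gt0 //; apply/negP => p_dvd.
  have p_qi : (p %| q ^ i.+1)%N.
    have [[|k] qE] := p_natP p_q; first by have := finNzRing_gt1 F; rewrite qE.
    by rewrite qE -expnM mulSn expnD dvdn_mulr // dvdn_exp.
  by move: p_dvd; rewrite dvdn_subr ?(ltnW q_gt1) // dvdn1; case: eqP p_pr => // ->.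
have dvd_n : (#|unitri b| %| n)%N.
  rewrite -(@Gauss_dvdr _ m); last by apply: pnat_coprime pW p'm.
  by rewrite -cardG cardSg // subsetT.
have n_gt0 : (0 < n)%N.
  by apply: prodn_gt0 => i; rewrite expn_gt0 ltnW // finNzRing_gt1.
have cardW : #|unitri b| = n.
  by apply/eqP; rewrite eqn_leq dvdn_leq // card_unitri.
rewrite /pHall subsetT pW -divgS ?subsetT // cardG cardW mulnK //.
Qed.

(** By Sylow, a maximal unipotent subgroup lies in a conjugate of the
    unitriangular group; the latter is unitriangular in the transported
    basis. *)
Lemma maximal_unipotent_unitri (U : {group gl V}) : (0 < r)%N ->
    maximal_unipotent U ->
  exists2 b : r.-tuple V, basis_of {:V} b & U = unitri b :> {set gl V}.
Proof.
move=> r_gt0 [uniU maxU]; have [p p_pr charFp] := finPcharP F.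
pose e := vbasis {:V}; have e_basis : basis_of {:V} e := vbasisP _.
have [x _ sUW] := Sylow_subJ (unitri_sylow r_gt0 e_basis charFp)
  (subsetT U) (unipotent_pgroup charFp uniU).
pose y := x^-1%g; pose b := map_tuple y e.
have spanb (s : seq V) : <<map y s>>%VS = (gl_val y @: <<s>>)%VS by rewrite limg_span.
have b_basis : basis_of {:V} b.
  rewrite basisEdim size_tuple leqnn andbT; apply/subvP => v _.
  rewrite spanb (span_basis e_basis) -(gl_invK y v); apply: memv_img.
  exact: memvf.
exists b => //; have sUb : U \subset unitri b.
  apply: (subset_trans sUW); apply/subsetP => _ /imsetP[w /unitriP wP ->].
  apply/unitriP => i lt_ir; rewrite (nth_map 0) ?size_tuple //.
  rewrite /conjg /= !comp_lfunE gl_invK -linearB -map_take spanb.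
  by apply: memv_img; apply: wP.
by rewrite -(maxU (unitri_group b) (unitri_unipotent b_basis) sUb).
Qed.

End MaximalUnipotent.

(** * Degrees *)

Section Degrees.
Variables (F : finFieldType) (V : vectType F).
Local Notation K := (SymFrac F V).
Local Notation c := (symfracC V).
Local Notation q := #|F|.

Definition shom d (y : K) := exists2 a : SymAlg F V, a \is d.-homog & y = a%:F.

Lemma shom0 d : shom d 0.
Proof. by exists 0; rewrite ?dhomog0 ?tofrac0. Qed.

Lemma shom1 : shom 0 1.
Proof. by exists 1; rewrite ?dhomog1 ?tofrac1. Qed.

Lemma shomD d y z : shom d y -> shom d z -> shom d (y + z).
Proof. by move=> [a ha ->] [b hb ->]; exists (a + b); rewrite ?rpredD ?tofracD. Qed.

Lemma shomN d y : shom d y -> shom d (- y).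
Proof. by move=> [a ha ->]; exists (- a); rewrite ?rpredN ?tofracN. Qed.

Lemma shomM d e y z : shom d y -> shom e z -> shom (d + e) (y * z).
Proof. by move=> [a ha ->] [b hb ->]; exists (a * b); rewrite ?dhomogM ?tofracM. Qed.

Lemma shomX d n y : shom d y -> shom (d * n) (y ^+ n).
Proof.
move=> hy; elim: n => [|n IHn]; first by rewrite muln0; apply: shom1.
by rewrite exprS mulnS; apply: shomM.
Qed.

Lemma shom_sum d (I : Type) (s : seq I) (P : pred I) (f : I -> K) :
  (forall i, P i -> shom d (f i)) -> shom d (\sum_(i <- s | P i) f i).
Proof. by move=> hf; apply: big_ind => //; [apply: shom0 | apply: shomD]. Qed.

Lemma shom_vecfrac v : shom 1 (vecfrac v).
Proof.
exists (symv v) => //; apply: rpred_sum => i _; apply: rpredZ.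
by rewrite dhomogX; apply/eqP; exact: mdeg1.
Qed.

Lemma frac_homog_div m n (d : int) y z : shom m y -> shom n z -> z != 0 ->
  d = m%:Z - n%:Z -> frac_homog d (y / z).
Proof.
move=> [a ha ->] [b hb ->]; rewrite tofrac_eq0 => b0 dE.
by exists m, n, a, b.
Qed.

Variables (r : nat) (b : seq V).
Local Notation x := (fun i => vecfrac b`_i).
Local Notation dickson := (dickson F x).
Local Notation orbprod := (orbprod F x).

Lemma shom_dickson_orbprod i :
  (forall j, shom (q ^ i - q ^ j) (dickson i j)) /\ shom (q ^ i) (orbprod i).
Proof.
have q_gt0 := card_F_gt0 F.
have le_q k j : (k <= j)%N -> (q ^ k <= q ^ j)%N by move=> *; rewrite leq_pexp2l.
have orbprod_of k : (forall j, shom (q ^ k - q ^ j) (dickson k j)) -> shom (q ^ k) (orbprod k).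
  move=> hk; apply: shom_sum => j _.
  have -> : (q ^ k = (q ^ k - q ^ j) + 1 * q ^ j)%N.
    by rewrite mul1n subnK // le_q // -ltnS ltn_ord.
  apply: shomM; first exact: hk.
  exact/shomX/shom_vecfrac.
elim: i => [|i [hi hg]].
  suff h0 j : shom (q ^ 0 - q ^ j) (dickson 0 j) by split=> //; apply: orbprod_of.
  by case: j => [|j] /=; [apply: shom1 | apply: shom0].
suff hS j : shom (q ^ i.+1 - q ^ j) (dickson i.+1 j) by split=> //; apply: orbprod_of.
have hw k : (k <= i)%N -> shom (q ^ i.+1 - q ^ k) (orbprod i ^+ q.-1 * dickson i k).
  move=> le_ki; have -> : (q ^ i.+1 - q ^ k = q ^ i * q.-1 + (q ^ i - q ^ k))%N.
    by rewrite addnBA ?le_q // -mulnSr prednK // expnSr.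
  by apply: shomM => //; apply: shomX.
case: j => [|j]; first by rewrite dicksonS0; apply/shomN/hw.
rewrite dicksonSS; apply: shomD.
  by rewrite !expnSr -mulnBl; apply: shomX.
apply: shomN; have [/hw//|lt_ij] := leqP j.+1 i.
by rewrite dickson_gt // mulr0; apply: shom0.
Qed.

Lemma shom_dickson i j : shom (q ^ i - q ^ j) (dickson i j).
Proof. by case: (shom_dickson_orbprod i). Qed.

Lemma shom_orbprod i : shom (q ^ i) (orbprod i).
Proof. by case: (shom_dickson_orbprod i). Qed.

Lemma shom_orbprods i : shom (\sum_(j < i) q ^ j) (orbprods F x i).
Proof.
rewrite /orbprods; elim: i => [|i IHi]; first by rewrite !big_ord0; apply: shom1.
by rewrite !big_ord_recr; apply: shomM => //; apply: shom_orbprod.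
Qed.

End Degrees.

(** * Freeness and invariants *)

Section Freeness.
Variables (F : finFieldType) (V : vectType F).
Local Notation K := (SymFrac F V).
Local Notation c := (symfracC V).
Local Notation q := #|F|.
Local Notation r := (\dim {:V}).
Local Notation sa := (subalg c).

Lemma eq_freely_generated (A B : K -> Prop) n (f g : 'I_n -> K) : (forall y, A y <-> B y) ->
  f =1 g -> freely_generated c A f -> freely_generated c B g.
Proof.
move=> AB fg [indep Af]; split=> [p gp|y].
  apply: indep; rewrite -gp; apply: eq_bigr => m _; congr (_ * _).
  exact: mmap1_eq.
by rewrite -AB Af; split; apply: subalg_trans => _ [i ->]; apply subalg_gen; exists i.
Qed.

Lemma variables_independent : algebraically_independent c (fun i : 'I_r => ('X_i)%:F).
Proof.
move=> p; suff -> : mmap c (fun i : 'I_r => ('X_i)%:F) p = p%:F.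
  by move/eqP; rewrite tofrac_eq0 => /eqP.
rewrite [in RHS](mpolyE p) rmorph_sum; apply: eq_bigr => m _.
rewrite -mul_mpolyC rmorphM; congr (_ * _); rewrite mpolyXE_id rmorph_prod.
by apply: eq_bigr => i _; rewrite rmorphXn.
Qed.

(** Clearing denominators reverses the exponents. *)
Lemma inverses_independent n (y : 'I_n -> K) : (forall i, y i != 0) ->
  algebraically_independent c y -> algebraically_independent c (fun i => (y i)^-1).
Proof.
move=> y0 indep p py; apply/eqP; apply: contraT => p0.
pose N := msize p; pose rev (m : 'X_{1..n}) : 'X_{1..n} := [multinom (N - m i)%N | i < n].
have le_N m i : m \in msupp p -> (m i <= N)%N.
  move=> pm; apply: leq_trans (ltnW (msize_mdeg_lt pm)).
  by rewrite mdegE (bigD1 i) //= leq_addr.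
pose p' := \sum_(m <- msupp p) p@_m *: 'X_[rev m].
have p'0 : p' = 0.
  apply: indep; rewrite rmorph_sum /=.
  transitivity ((\prod_i y i ^+ N) * mmap c (fun i => (y i)^-1) p).
    rewrite mulr_sumr big_seq [RHS]big_seq; apply: eq_bigr => m pm.
    rewrite mmapZ mmapX mulrCA; congr (_ * _); rewrite -big_split.
    apply: eq_bigr => i _; rewrite mnmE exprVn.
    by rewrite expfB_cond ?le_N // (negPf (y0 i)) add0n le_N.
  by rewrite py mulr0.
have lead_p := mlead_supp p0.
have := congr1 (mcoeff (rev (mlead p))) p'0.
rewrite linear_sum mcoeff0 (bigD1_seq (mlead p)) ?msupp_uniq //=.
rewrite mcoeffZ mcoeffX eqxx mulr1 big_seq_cond big1 ?addr0.
  by move/eqP; rewrite mcoeff_eq0 lead_p.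
move=> m /andP[pm m_lead]; rewrite mcoeffZ mcoeffX; case: eqP => [rev_m|]; last first.
  by rewrite mulr0.
case/eqP: m_lead; apply/mnmP=> i.
have := congr1 (fun k : 'X_{1..n} => k i) rev_m; rewrite !mnmE => E.
by rewrite -(subKn (le_N m i pm)) E subKn // le_N.
Qed.

Section Ring.
Variables (Y : K -> Prop) (y : 'I_r -> K).
Hypothesis indep_y : algebraically_independent c y.
Hypothesis Yy : forall i, sa Y (y i).

(** A ring that is finite over F[z] and contains r independent elements has
    transcendence degree r, so the r elements z i are independent. *)
Lemma spans_indep (z : 'I_r -> K) X n :
    (forall t, sa X t -> sa (values z) t) -> spans (sa X) (sa Y) n ->
  algebraically_independent c z.
Proof.
move=> Xz [s [_ _ _ sY Ys]].
have mono t : span (sa X) s t -> span (sa (values z)) s t.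
  by case=> a Xa ->; exists a => // i; apply: Xz.
apply: (alg_indep_of_finite indep_y (s := s)).
  by apply/mono/Ys/subalg1.
by move=> i t /sY Yt; apply/mono/Ys/subalg_mul.
Qed.

Hypothesis distY : forall g h : gl V, g != h ->
  exists2 t, sa Y t & symfrac_act g t != symfrac_act h t.

Lemma invariants_freely_generated (H : {group gl V}) (z : 'I_r -> K) n :
    (forall g i, g \in H -> symfrac_act g (z i) = z i) ->
    (forall i, sa Y (z i)) ->
    spans (sa (values z)) (sa Y) n -> (n <= #|H|)%N ->
  freely_generated c (fun t => sa Y t /\ forall g, g \in H -> symfrac_act g t = t) z.
Proof.
move=> fix_z Yz spans_z le_n; split; first exact: spans_indep spans_z.
have fixA g t : g \in H -> sa (values z) t -> symfrac_act g t = t.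
  move=> Hg; apply: (subalg_fixed (sigma := symfrac_act g)) => [a|_ [i ->]].
    exact: symfrac_act_c.
  exact: fix_z.
move=> t; split=> [[Yt fix_t]|zt]; last first.
  split=> [|g Hg]; last exact: fixA.
  by apply: subalg_trans zt => _ [i ->].
pose I := {g : gl V | g \in H}.
apply: (invariants_of_spans (sigma := fun i : I => symfrac_act (val i)) _ _ spans_z) => //.
- by move=> i w; apply: fixA (valP i).
- by move=> i j; apply: distY.
- by rewrite card_sig.
by move=> i; apply/fix_t/(valP i).
Qed.

(** The invariant z i0 is replaced by its (q - 1)-st root eta, up to a scalar.
    The new algebra contains F[z], so Y is finite over it, which makes the new
    generators independent. *)
Lemma kernel_freely_generated (chi : gl V -> F) (z : 'I_r -> K) (i0 : 'I_r) eta u n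
    (H : {set gl V}) :
    (forall g h, chi (g * h)%g = chi g * chi h) -> (forall g, chi g != 0) ->
    (forall a, a != 0 -> exists g, chi g = a) ->
    (forall g, (g \in H) = (chi g == 1)) ->
    (forall g t, sa Y t -> sa Y (symfrac_act g t)) ->
    spans (sa (values z)) (sa Y) n ->
    freely_generated c
      (fun t => sa Y t /\ forall g, g \in [set: gl V] -> symfrac_act g t = t) z ->
    sa Y eta -> eta != 0 -> u != 0 ->
    (forall g, symfrac_act g eta = c (chi g) * eta) ->
    z i0 = c u * eta ^+ q.-1 ->
  freely_generated c (fun t => sa Y t /\ forall g, g \in H -> symfrac_act g t = t)
    (fun i => if i == i0 then eta else z i).
Proof.
move=> chiM chi0 chi_onto HE stabY spans_z [indep_z inv_z] Y_eta eta0 u0 act_eta z_eta.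
have sub_eta t : sa (values z) t -> sa (values (fun i => if i == i0 then eta else z i)) t.
  exact: values_sub_eta z_eta t.
split; first exact: spans_indep sub_eta spans_z.
move=> t; split=> [[Yt fix_t]|zt].
  have fixed_in w : sa Y w -> (forall g, symfrac_act g w = w) -> sa (values z) w.
    by move=> Yw fix_w; apply/inv_z; split=> // g _; apply: fix_w.
  apply: (kernel_invariants (sigma := fun g => symfrac_act g) (@symfrac_actM _ _)
    (@symfrac_act_c _ _) chiM chi0 chi_onto stabY indep_z fixed_in Y_eta eta0 u0
    act_eta z_eta Yt).
  by move=> g chi_g; apply: fix_t; rewrite HE chi_g.
have Yz i : sa Y (z i).
  by have /inv_z[] : sa (values z) (z i) by apply subalg_gen; exists i.
split.
  by apply: subalg_trans zt => _ [i ->]; case: ifP.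
move=> g; rewrite HE => /eqP chi_g; move: zt.
apply: (subalg_fixed (sigma := symfrac_act g)) => [a|_ [i ->]].
  exact: symfrac_act_c.
case: ifP => _; first by rewrite /= act_eta chi_g rmorph1 mul1r.
have /inv_z[_ fix_z] : sa (values z) (z i) by apply subalg_gen; exists i.
by apply: fix_z; rewrite inE.
Qed.

End Ring.

(** The statement for S inside K descends to S, which embeds in K. *)
Lemma freely_generated_sym (H : {set gl V}) (b : r.-tuple V) n (g : 'I_n -> SymAlg F V) :
    basis_of {:V} b ->
    freely_generated c (fun t => sa (coords (bvec b) r) t /\
      forall h, h \in H -> symfrac_act h t = t) (fun i => (g i)%:F) ->
  freely_generated (symC V) (sym_inv H) g.
Proof.
move=> b_basis [indep inv]; split=> [p gp|p].
  apply: indep; rewrite -(tofrac0 (SymAlg F V)) -gp /mmap rmorph_sum.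
  apply: eq_bigr => m _; rewrite rmorphM; congr (_ * _); rewrite rmorph_prod.
  by apply: eq_bigr => i _; rewrite rmorphXn.
transitivity (sa (values (fun i => (g i)%:F)) p%:F).
  split=> [inv_p|/inv[_ fix_p] h Hh].
    apply/inv; split=> [|h Hh]; first by apply/(sym_algE b_basis); exists p.
    by rewrite symfrac_act_tofrac inv_p.
  by apply/eqP; rewrite -tofrac_eq -symfrac_act_tofrac fix_p.
split=> [|gp]; last first.
  elim: gp => [a|_ [i ->]|p1 p2 _ IH1 _ IH2|p1 p2 _ IH1 _ IH2].
  - exact: (subalg_const c).
  - by apply subalg_gen; exists i.
  - by rewrite tofracD; apply: subalg_add.
  by rewrite tofracM; apply: subalg_mul.
move: {-1}p%:F (erefl p%:F) => t + zt.
elim: zt p => [a|_ [i ->]|t1 t2 zt1 IH1 zt2 IH2|t1 t2 zt1 IH1 zt2 IH2] p.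
- by move/eqP; rewrite /symfracC tofrac_eq => /eqP->; apply: (subalg_const (symC V)).
- by move/eqP; rewrite tofrac_eq => /eqP->; apply subalg_gen; exists i.
all: have sub z : sa (values (fun i => (g i)%:F)) z -> exists p, z = p%:F
  by move/inv=> [/(sym_algE b_basis)].
- have [[p1 E1] [p2 E2]] := (sub _ zt1, sub _ zt2).
  rewrite E1 E2 -tofracD => /eqP; rewrite tofrac_eq => /eqP->.
  by apply: subalg_add; [apply: IH1 | apply: IH2].
have [[p1 E1] [p2 E2]] := (sub _ zt1, sub _ zt2).
rewrite E1 E2 -tofracM => /eqP; rewrite tofrac_eq => /eqP->.
by apply: subalg_mul; [apply: IH1 | apply: IH2].
Qed.

End Freeness.

(** * The six rings of invariants *)

Section SixRings.
Variables (F : finFieldType) (V : vectType F).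
Local Notation K := (SymFrac F V).
Local Notation c := (symfracC V).
Local Notation q := #|F|.
Local Notation r := (\dim {:V}).
Local Notation sa := (subalg c).

Lemma eq_spans (A A' B : K -> Prop) n :
  (forall t, A t <-> A' t) -> spans A B n -> spans A' B n.
Proof.
move=> AA' [s [sz_s s0 n0 sB Bs]]; exists s; split=> // t /Bs[a Aa ->].
by exists a => // i; apply/AA'.
Qed.

Lemma gl_moves (g h : gl V) : g != h -> exists v, v != 0 /\ vecfrac (g v) != vecfrac (h v).
Proof.
move=> gh; have e_basis := vbasisP {:V}.
have /existsP[i gh_i] : [exists i : 'I_r, g (vbasis {:V})`_i != h (vbasis {:V})`_i].
  apply: contraR gh; rewrite negb_exists => /forallP gh.
  apply/eqP/(gl_basis_ext e_basis) => i; apply/eqP.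
  by have := gh i; rewrite negbK.
exists (vbasis {:V})`_i; rewrite (inj_eq (@vecfrac_inj _ _)); split=> //.
by apply: contraNneq gh_i => ->; rewrite !linear0.
Qed.

Section Flag.
Variable b : r.-tuple V.
Hypothesis b_basis : basis_of {:V} b.
Let x_free := bvec_free b_basis.
Local Notation x := (bvec b).
Local Notation recipY := (recips c x r).
Local Notation symY := (coords x r).

Lemma vec_sym v : sa symY (vecfrac v).
Proof. by apply/(sym_algE b_basis); exists (symv v). Qed.

Lemma vec_recip v : v != 0 -> sa recipY (vecfrac v)^-1.
Proof.
move=> v0; apply subalg_gen; exists (vecfrac v); rewrite vecfrac_eq0; split=> //.
by apply/(flag_full b_basis); exists v.
Qed.

Lemma sym_variable (i : 'I_r) : sa symY ('X_i)%:F.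
Proof. by rewrite -symv_basis; apply: vec_sym. Qed.

Lemma vbasis_neq0 (i : 'I_r) : (vbasis {:V})`_i != 0.
Proof.
by apply: (free_not0 (basis_free (vbasisP {:V}))); rewrite mem_nth ?size_tuple.
Qed.

Lemma recip_variable (i : 'I_r) : sa recipY (('X_i)%:F)^-1.
Proof. by rewrite -symv_basis; apply/vec_recip/vbasis_neq0. Qed.

Lemma recip_independent : algebraically_independent c (fun i : 'I_r => (('X_i)%:F)^-1).
Proof.
apply: inverses_independent; last exact: variables_independent.
by move=> i; rewrite tofrac_eq0 -symv_basis symv_eq0 vbasis_neq0.
Qed.

Lemma sym_moves (g h : gl V) : g != h ->
  exists2 t, sa symY t & symfrac_act g t != symfrac_act h t.
Proof.
move=> /gl_moves[v [_ gh_v]]; exists (vecfrac v); first exact: vec_sym.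
by rewrite !symfrac_act_vec.
Qed.

Lemma recip_moves (g h : gl V) : g != h ->
  exists2 t, sa recipY t & symfrac_act g t != symfrac_act h t.
Proof.
move=> /gl_moves[v [v0 gh_v]]; exists (vecfrac v)^-1; first exact: vec_recip.
by rewrite !symfrac_actV (inj_eq invr_inj).
Qed.

Lemma values_ex (f : nat -> K) t :
  (exists2 i, (i < r)%N & t = f i) <-> values (fun i : 'I_r => f i) t.
Proof.
split=> [[i lt_ir ->]|[i ->]]; first by exists (Ordinal lt_ir).
by exists i.
Qed.

Lemma sa_values_ex (f : nat -> K) (A : K -> Prop) t :
    (forall t, A t <-> exists2 i, (i < r)%N & t = f i) ->
  sa A t <-> sa (values (fun i : 'I_r => f i)) t.
Proof.
move=> AE; apply: subalg_equiv => z.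
  by move=> /AE/values_ex fz; apply: subalg_gen.
by move=> /values_ex/AE; apply: subalg_gen.
Qed.

Lemma spans_values (f : nat -> K) (A B : K -> Prop) n :
    (forall t, A t <-> exists2 i, (i < r)%N & t = f i) ->
  spans (sa A) B n -> spans (sa (values (fun i : 'I_r => f i))) B n.
Proof. by move=> AE; apply: eq_spans => t; apply: sa_values_ex. Qed.

Lemma unitri_act (g : gl V) j : g \in unitri b -> (j < r)%N ->
  symfrac_act g (x j) - x j \in flag c x j.
Proof.
move=> /unitriP ug lt_jr; rewrite /bvec symfrac_act_vec -vecfracB.
by apply/(flag_vecP b _ (ltnW lt_jr)); exists (g b`_j - b`_j) => //; apply: ug.
Qed.

Lemma sym_unitri : freely_generated c
  (fun t => sa symY t /\ forall g, g \in unitri b -> symfrac_act g t = t)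
  (fun i : 'I_r => orbprod F x i).
Proof.
apply: (invariants_freely_generated (@variables_independent F V) sym_variable sym_moves
   (H := unitri_group b) (n := \prod_(i < r) q ^ i)).
- by move=> g i ug; apply: (orbprod_unitri (ltn_ord i)) => j; apply: unitri_act.
- by move=> i; apply: sa_coords_mono (orbprod_coords _ x i).
- by apply: (spans_values (f := orbprod F x) _ (spans_sym_unitri _ r x)).
exact: card_unitri.
Qed.

Lemma recip_unitri : freely_generated c
  (fun t => sa recipY t /\ forall g, g \in unitri b -> symfrac_act g t = t)
  (fun i : 'I_r => rorbsum F x i).
Proof.
have gensE t : rorbsum_gens F r x 0 t <-> exists2 i, (i < r)%N & t = rorbsum F x i by [].
apply: (invariants_freely_generated recip_independent recip_variable recip_moves
   (H := unitri_group b) (n := \prod_(i < r) q ^ i)).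
- by move=> g i ug; apply: (rorbsum_unitri (ltn_ord i)) => j; apply: unitri_act.
- by move=> i; apply: (rorbsum_gens_recips x_free); apply/gensE; exists i.
- by apply: (spans_values (f := rorbsum F x) gensE (spans_recip_unitri x_free)).
exact: card_unitri.
Qed.

Hypothesis r_gt0 : (0 < r)%N.

Lemma dickson_gl (g : gl V) j : symfrac_act g (dickson F x r j) = dickson F x r j.
Proof.
by apply: (dickson_stable x_free (sigma := symfrac_act g)) => v; apply: (flag_act b_basis).
Qed.

Lemma card_gl_sym : #|{: gl V}| = (\prod_(i < r) (q ^ r - q ^ i))%N.
Proof.
rewrite (card_gl b_basis) // (reindex_inj rev_ord_inj) -big_split /=.
apply: eq_bigr => i _; rewrite subnSK // mulnBl mul1n -expnD subnK //.
exact: ltnW.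
Qed.

Lemma sym_gl : freely_generated c
  (fun t => sa symY t /\ forall g, g \in [set: gl V] -> symfrac_act g t = t)
  (fun i : 'I_r => dickson F x r i).
Proof.
apply: (invariants_freely_generated (@variables_independent F V) sym_variable sym_moves
   (H := [group of [set: gl V]]) (n := \prod_(i < r) (q ^ r - q ^ i))).
- by move=> g i _; apply: dickson_gl.
- by move=> i; apply: dickson_coords.
- by apply: (spans_values (f := dickson F x r) _ (spans_sym_gl x_free)).
by rewrite cardsT card_gl_sym.
Qed.

Lemma recip_gl : freely_generated c
  (fun t => sa recipY t /\ forall g, g \in [set: gl V] -> symfrac_act g t = t)
  (fun i : 'I_r => rdickson F x r i.+1).
Proof.
apply: (invariants_freely_generated recip_independent recip_variable recip_moves
   (H := [group of [set: gl V]])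
   (n := (\prod_(i < r) (q ^ i.+1 - 1)) * \prod_(i < r) q ^ i)).
- by move=> g i _; apply: (rdickson_stable x_free) => v; apply: (flag_act b_basis).
- move=> i; apply: subalg_trans (rdickson_rorbsum_gens x_free i.+1 (leqnn r)).
  exact: (rorbsum_gens_recips x_free).
- by apply: (spans_values (f := fun i => rdickson F x r i.+1) _ (spans_recip_gl x_free)).
by rewrite cardsT (card_gl b_basis).
Qed.

End Flag.

Local Notation e := (vbasis {:V}).
Let e_basis : basis_of {:V} e := vbasisP _.
Let e_free := bvec_free e_basis.
Local Notation x := (bvec e).
Hypothesis r_gt0 : (0 < r)%N.

Lemma gl_detM (g h : gl V) : gl_det (g * h)%g = gl_det g * gl_det h.
Proof. by rewrite /gl_det (gl_mxM e_basis) det_mulmx mulrC. Qed.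

Lemma gl_det_neq0 (g : gl V) : gl_det g != 0.
Proof. by rewrite -unitfE -unitmxE (gl_mx_unit e_basis). Qed.

Lemma gl_det_onto a : a != 0 -> exists g : gl V, gl_det g = a.
Proof.
move=> a0; pose i0 := Ordinal r_gt0.
pose M : 'M[F]_r := diag_mx (\row_i (if i == i0 then a else 1)).
have detM : \det M = a.
  rewrite det_diag (bigD1 i0) //= mxE eqxx big1 ?mulr1 // => i /negPf i_i0.
  by rewrite mxE i_i0.
have [|g gM] := gl_of_mx e_basis (M := M); first by rewrite unitmxE detM unitfE.
by exists g; rewrite /gl_det gM.
Qed.

Lemma orbprods_act (g : gl V) :
  symfrac_act g (orbprods F x r) = c (gl_det g) * orbprods F x r.
Proof.
apply: orbprods_semi_invariant => i.
rewrite /= symfrac_act_vec (gl_mxE e_basis) vecfrac_sum.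
by apply: eq_bigr => j _; rewrite vecfracZ.
Qed.

Lemma dickson_orbprods : dickson F x r 0 = c ((-1) ^+ r) * orbprods F x r ^+ q.-1.
Proof. by rewrite dickson0E rmorphXn /= rmorphN1. Qed.

Lemma sym_sl : freely_generated c
  (fun t => sa (coords x r) t /\ forall g, g \in sl V -> symfrac_act g t = t)
  (fun i : 'I_r => if i == Ordinal r_gt0 then orbprods F x r else dickson F x r i).
Proof.
have gensE t : dickson_gens F r x t <-> exists2 i, (i < r)%N & t = dickson F x r i by [].
apply: (kernel_freely_generated (@variables_independent F V) (sym_variable e_basis)
  (z := fun i : 'I_r => dickson F x r i) (i0 := Ordinal r_gt0)
  gl_detM gl_det_neq0 gl_det_onto _ _
  (spans_values (f := dickson F x r) gensE (spans_sym_gl e_free)) (sym_gl e_basis r_gt0)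
  _ _ _ orbprods_act
  dickson_orbprods) => //.
- by move=> g; rewrite inE.
- move=> g t /(sym_algE e_basis)[p ->]; apply/(sym_algE e_basis).
  by rewrite symfrac_act_tofrac; exists (sym_act g p).
- rewrite /orbprods; apply: subalg_prod_mem => i _.
  exact: sa_coords_mono (orbprod_coords _ x i).
- exact: (orbprods_neq0 e_free).
by rewrite expf_neq0 // oppr_eq0 oner_neq0.
Qed.

Lemma last_ord_proof : (r.-1 < r)%N.
Proof. by rewrite ltn_predL. Qed.

Lemma recip_sl : freely_generated c
  (fun t => sa (recips c x r) t /\ forall g, g \in sl V -> symfrac_act g t = t)
  (fun i : 'I_r => if i == Ordinal last_ord_proof then (orbprods F x r)^-1
                   else rdickson F x r i.+1).
Proof.
have gensE t : rdickson_gens F r x t <-> exists2 i, (i < r)%N & t = rdickson F x r i.+1 by [].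
have spans_hh := spans_values (f := fun i => rdickson F x r i.+1) gensE (spans_recip_gl e_free).
pose chi (g : gl V) := (gl_det g)^-1.
have chiM g h : chi (g * h)%g = chi g * chi h by rewrite /chi gl_detM invfM.
have chi_neq0 g : chi g != 0 by rewrite invr_eq0 gl_det_neq0.
have chi_onto a : a != 0 -> exists g, chi g = a.
  move=> a0; have [|g gE] := @gl_det_onto a^-1; first by rewrite invr_eq0.
  by exists g; rewrite /chi gE invrK.
have slE g : (g \in sl V) = (chi g == 1) by rewrite inE invr_eq1.
have stab (g : gl V) t : sa (recips c x r) t -> sa (recips c x r) (symfrac_act g t).
  elim=> [a|_ [_ [/(flag_full e_basis)[v ->] v0 ->]]||].
  - by rewrite symfrac_act_c; apply: subalg_const.
  - rewrite symfrac_actV; apply: (vec_recip e_basis); rewrite -vecfrac_eq0.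
    by rewrite -symfrac_act_vec fmorph_eq0.
  - by move=> t1 t2 _ IH1 _ IH2; rewrite rmorphD; apply: subalg_add.
  by move=> t1 t2 _ IH1 _ IH2; rewrite rmorphM; apply: subalg_mul.
have eta_neq0 : (orbprods F x r)^-1 != 0 by rewrite invr_eq0 (orbprods_neq0 e_free).
have u_neq0 : (-1) ^+ r != 0 :> F by rewrite expf_neq0 // oppr_eq0 oner_neq0.
have act_eta g : symfrac_act g (orbprods F x r)^-1 = c (chi g) * (orbprods F x r)^-1.
  by rewrite fmorphV /= orbprods_act invfM (fmorphV (symfracC V)).
have rdickson_eta : rdickson F x r (Ordinal last_ord_proof).+1 =
    c ((-1) ^+ r) * (orbprods F x r)^-1 ^+ q.-1.
  by rewrite /= prednK // rmorphXn rmorphN1 rdickson_orbprods.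
exact: (kernel_freely_generated recip_independent (recip_variable e_basis) chiM
  chi_neq0 chi_onto slE stab spans_hh (recip_gl e_basis r_gt0)
  (orbprods_inv_recips e_free) eta_neq0 u_neq0 act_eta rdickson_eta).
Qed.

End SixRings.

Lemma natz_exp (m n : nat) : (m ^ n)%N%:Z = m%:Z ^+ n.
Proof. by elim: n => // n IHn; rewrite expnS PoszM IHn exprS. Qed.

Theorem theorem3p1 (F : finFieldType) (q : nat) (hq : #|F| = q)
    (V : vectType F) (r : nat) (hV : \dim {:V} = r) (hr : (1 <= r)%N)
    (U : {group gl V}) (hU : maximal_unipotent U) :
  exists (f : 'I_r -> SymFrac F V) (g : 'I_r -> SymAlg F V)
         (h : 'I_r -> SymFrac F V) (k : 'I_r -> SymAlg F V)
         (h' : SymFrac F V) (k' : SymAlg F V),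
    [/\ freely_generated (symfracC V) (recip_inv U) f
        /\ (forall i, frac_homog (-1) (f i)),
        freely_generated (symC V) (sym_inv U) g
        /\ (forall i : 'I_r, g i \is (q ^ i)%N.-homog),
        freely_generated (symfracC V) (recip_inv [set: gl V]) h
        /\ (forall i : 'I_r, frac_homog (1 - q%:Z ^+ i.+1) (h i)),
        freely_generated (symC V) (sym_inv [set: gl V]) k
        /\ (forall i : 'I_r, k i \is (q ^ r - q ^ i)%N.-homog)
      & (freely_generated (symfracC V) (recip_inv (sl V))
           (fun i => if i.+1 == r then h' else h i)
         /\ frac_homog ((1 - q%:Z ^+ r) %/ (q%:Z - 1))%Z h')
        /\ (freely_generated (symC V) (sym_inv (sl V))
              (fun i => if i == 0%N :> nat then k' else k i)
            /\ k' \is ((q ^ r - 1) %/ (q - 1))%N.-homog)].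
Proof.
subst q r; have [b b_basis ->] := maximal_unipotent_unitri hr hU.
have e_basis := vbasisP {:V}; set e := vbasis _ in e_basis *.
have e_free := bvec_free e_basis; have b_free := bvec_free b_basis.
have q_gt0 := card_F_gt0 F.
have le_q i j : (i <= j)%N -> (#|F| ^ i <= #|F| ^ j)%N.
  by move=> *; rewrite leq_pexp2l.
have hdickson (b' : (\dim {:V}).-tuple V) i j :
    shom (#|F| ^ i - #|F| ^ j) (dickson F (bvec b') i j) by exact: (shom_dickson b' i j).
have /fin_all_exists2[g g_homog gE] (i : 'I_(\dim {:V})) :
  exists2 p : SymAlg F V, p \is (#|F| ^ i)%N.-homog & orbprod F (bvec b) i = p%:F.
  exact: (shom_orbprod b i).
have /fin_all_exists2[k k_homog kE] (i : 'I_(\dim {:V})) :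
    exists2 p : SymAlg F V, p \is (#|F| ^ \dim {:V} - #|F| ^ i)%N.-homog
                          & dickson F (bvec e) (\dim {:V}) i = p%:F.
  exact: hdickson.
have [k' k'_homog k'E] := shom_orbprods e (\dim {:V}).
have recipE (H : {set gl V}) n (f : 'I_n -> SymFrac F V) (b' : (\dim {:V}).-tuple V) :
    basis_of {:V} b' ->
    freely_generated (symfracC V) (fun t => subalg (symfracC V)
        (recips (symfracC V) (bvec b') (\dim {:V})) t /\
      forall g, g \in H -> symfrac_act g t = t) f ->
    freely_generated (symfracC V) (recip_inv H) f.
  move=> b'_basis; apply: eq_freely_generated => // t.
  by rewrite /recip_inv (recip_algE b'_basis).
exists (fun i => rorbsum F (bvec b) i), g,
  (fun i => rdickson F (bvec e) (\dim {:V}) i.+1), k,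
  (orbprods F (bvec e) (\dim {:V}))^-1, k'.
split; [split|split|split|split|split; split].
- exact: recipE b_basis (recip_unitri b_basis).
- move=> i; apply: (frac_homog_div (hdickson b i 0) (shom_orbprod b i)).
    by apply: (orbprod_neq0 b_free).
  rewrite expn0 -subzn ?expn_gt0 ?q_gt0 //.
  by rewrite addrAC subrr add0r.
- apply: (freely_generated_sym b_basis (g := g)).
  by apply: eq_freely_generated (sym_unitri b_basis).
- exact: g_homog.
- exact: recipE e_basis (recip_gl e_basis hr).
- move=> i; apply: (frac_homog_div (hdickson e _ _) (hdickson e _ 0)).
    exact: (dickson0_neq0 e_free).
  rewrite expn0 -natz_exp -!subzn ?le_q ?expn_gt0 ?q_gt0 //.
  by ring.
- apply: (freely_generated_sym e_basis (g := k)).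
  by apply: eq_freely_generated (sym_gl e_basis hr).
- exact: k_homog.
- apply: (recipE _ _ _ e e_basis); apply: eq_freely_generated (recip_sl hr) => // i.
  by rewrite -val_eqE /= -eqSS prednK.
- rewrite -[_^-1]mul1r; apply: (frac_homog_div (shom1 V) (shom_orbprods e _)).
    exact: (orbprods_neq0 e_free).
  have q1_neq0 : #|F|%:Z - 1 != 0.
    by rewrite subr_eq0 eqz_nat neq_ltn finNzRing_gt1 orbT.
  rewrite -opprB subrX1 mulrC -mulNr mulzK // sub0r; congr (- _).
  by rewrite (big_morph Posz PoszD (erefl _)); apply: eq_bigr => i _; rewrite natz_exp.
- apply: (freely_generated_sym e_basis
    (g := fun i : 'I__ => if i == 0%N :> nat then k' else k i)).
  apply: eq_freely_generated (sym_sl hr) => // i.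
  by rewrite -val_eqE /=; case: ifP => _; [apply: k'E | apply: kE].
have homogW d d' : d = d' -> k' \is d.-homog -> k' \is d'.-homog by move=> ->.
apply: homogW k'_homog; apply/esym; rewrite !subn1 predn_exp mulKn //.
exact: finField_card_gt1.
Qed.
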